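(* Let $\mathcal I=\{f_i=rR_\theta\cdot+a_i\}_{i=1}^m$ be an IFS on $\mathbb R^2$ with $r\in(0,1)$, $\theta\in[0,2\pi)$, $a_i\in\mathbb R^2$, and suppose $\theta/\pi$ is irrational. Let $\mu=\Phi\nu$ be the random measure defined below. Then almost surely, for all $\beta\in[0,\pi)$, $$\dim_H\pi_\beta\mu=\min(1,\dim_H\mu).$$
   Context: $R_\theta$ is rotation by angle $\theta$. $\Lambda=\{1,\dots,m\}$, $\Sigma=\Lambda^{\mathbb N}$, $\Phi:\Sigma\to\mathbb R^2$ the canonical coding map $\Phi(i_1i_2\dots)=\lim_n f_{i_1}\circ\cdots\circ f_{i_n}(0)$. $(\Omega,\mathcal A,\mathbb P)$ is a probability space, $X:\Omega\to\{(p_1,\dots,p_m)\in[0,1]^m:\sum_ip_i=1\}$ a random probability vector (zero entries allowed), and $X^{(n)}$, $n\in\mathbb N$, i.i.d. copies of $X$ (coordinates of $\Omega^{\mathbb N}$ with $\mathbb P^{\otimes\mathbb N}$). The random measure $\nu$ on $\Sigma$ is given by $\nu([i_1\dots i_k])=X^{(1)}_{i_1}\cdots X^{(k)}_{i_k}$, and $\mu=\Phi\nu$ is its image, $\mu(A)=\nu(\Phi^{-1}A)$. $\pi_\beta$ is orthogonal projection onto the line through the origin making angle $\beta$ with the $x$-axis, $\pi_\beta\mu$ the image measure. For a measure $\lambda$, $\dim_H\lambda=\inf\{\dim_H A: A \text{ Borel},\ \lambda(A)>0\}$. *)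

(* Defs.v *)
From HB Require Import structures.
From mathcomp Require Import all_boot all_order all_algebra.
From mathcomp Require Import all_classical all_reals all_analysis.
Set Implicit Arguments. Unset Strict Implicit. Unset Printing Implicit Defensive.
Import Order.TTheory GRing.Theory Num.Theory.
Import numFieldNormedType.Exports.
Local Open Scope classical_set_scope.
Local Open Scope ring_scope.

(* Lambda = {1,...,m} with m = n.+1 (an IFS has at least one map);
   we index it by 'I_n.+1 = {0,...,n}. *)
Definition Lam (n : nat) := 'I_n.+1.
HB.instance Definition _ n := Finite.on (Lam n).
HB.instance Definition _ n := isPointed.Build (Lam n) ord0.

Definition cyl (n : nat) (w : nat -> Lam n) (k : nat) : set (nat -> Lam n) :=
  [set s | forall j, (j < k)%N -> s j = w j].

Definition cylinders (n : nat) : set (set (nat -> Lam n)) :=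
  [set C | exists w k, C = cyl w k].

Definition Sigma (n : nat) := g_sigma_algebraType (@cylinders n).

Definition cylOm d (Om : measurableType d) (N : nat) (A : nat -> set Om)
  : set (nat -> Om) := [set om | forall k, (k < N)%N -> A k (om k)].

Definition cylindersOm d (Om : measurableType d) : set (set (nat -> Om)) :=
  [set C | exists N A, (forall k, measurable (A k)) /\ C = cylOm N A].

Definition OmegaN d (Om : measurableType d) := g_sigma_algebraType (@cylindersOm d Om).

(* Q is the product probability P^{(x)N} on Omega^N (determined by its
   values on measurable cylinders) *)
Definition is_product_measure d (R : realType) (Om : measurableType d)
  (P : probability Om R) (Q : set (OmegaN Om) -> \bar R) : Prop :=
  forall (N : nat) (A : nat -> set Om), (forall k, measurable (A k)) ->
    Q (cylOm N A) = (\prod_(k < N) fine (P (A k)))%:E.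

Definition edist (R : realType) (x y : R * R) : R :=
  Num.sqrt ((x.1 - y.1) ^+ 2 + (x.2 - y.2) ^+ 2).

Definition rot (R : realType) (theta : R) (x : R * R) : R * R :=
  (cos theta * x.1 - sin theta * x.2, sin theta * x.1 + cos theta * x.2).

Definition ifs_map (R : realType) (n : nat) (r theta : R) (a : Lam n -> R * R)
  (i : Lam n) (x : R * R) : R * R :=
  (r * (rot theta x).1 + (a i).1, r * (rot theta x).2 + (a i).2).

Fixpoint ifs_comp (R : realType) (n : nat) (r theta : R) (a : Lam n -> R * R)
  (s : nat -> Lam n) (k : nat) (x : R * R) : R * R :=
  match k with
  | 0 => x
  | k'.+1 => ifs_comp r theta a s k' (ifs_map r theta a (s k') x)
  end.

(* canonical coding map Phi(s) = lim_k f_{s_0} o ... o f_{s_{k-1}} (0)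
   (the limit exists; xget picks the (unique) limit point in R^2 with its
   usual product = Euclidean topology) *)
Definition coding (R : realType) (n : nat) (r theta : R) (a : Lam n -> R * R)
  (s : Sigma n) : R * R :=
  xget (0, 0) [set x : R * R |
    (fun k => ifs_comp r theta a s k (0, 0)) @ \oo --> x].

Definition proj_line (R : realType) (beta : R) (x : R * R) : R * R :=
  let t := x.1 * cos beta + x.2 * sin beta in (t * cos beta, t * sin beta).

Definition borel2 (R : realType) : set (set (R * R)) := <<s open >>.

Local Open Scope ereal_scope.

Definition diamE (R : realType) (U : set (R * R)) : \bar R :=
  ereal_sup [set (edist x y)%:E | x in U & y in U].

Definition cover_term (R : realType) (s : R) (U : set (R * R)) : \bar R :=
  if pselect (U = set0) then 0 else ((fine (diamE U)) `^ s)%:E.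

Definition hcontent (R : realType) (s delta : R) (A : set (R * R)) : \bar R :=
  ereal_inf [set \sum_(0 <= k <oo) cover_term s (F k) |
     F in [set F : nat -> set (R * R) |
             A `<=` \bigcup_k F k /\ (forall k, diamE (F k) <= delta%:E)]].

Definition hmeasure (R : realType) (s : R) (A : set (R * R)) : \bar R :=
  ereal_sup [set hcontent s delta A | delta in [set delta : R | (0 < delta)%R]].

Definition dimH (R : realType) (A : set (R * R)) : \bar R :=
  ereal_inf [set s%:E | s in [set s : R | (0 <= s)%R /\ hmeasure s A = 0]].

Definition dimH_meas (R : realType) (lam : set (R * R) -> \bar R) : \bar R :=
  ereal_inf [set dimH A | A in [set A | borel2 A /\ 0 < lam A]].

(* Main.v *)
(** Under nu the letters are independent, so mu is the law of a random series
whose tail, after k letters, is a copy of the measure built from the shifted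
environment, contracted by r^k and rotated by k theta.  Fix 0 < t < 1 and call
a word of length j heavy if the disc of radius about r^j around it has mass
more than r^(jt).  There are two cases.

If the nu-mass of heavy words of length j does not tend to 0 in probability,
choose independent far-apart blocks on which it stays bounded below; a second
Borel-Cantelli argument, and the fact that a short prefix costs little mass,
give heavy words at infinitely many levels almost surely, whence dim mu <= t+.

If it tends to 0 in probability, cut the sequence into blocks of length N.  The
number of times at which the rotated direction is nearly orthogonal to a given
vector is controlled by equidistribution of the orbit k theta; averaging over
the orbit, in place of Marstrand's integral over all angles, shows that for
most blocks most words are good: the interval of length about r^N around their
projection has mass at most r^(N(t-)).  Independence of the blocks turns this
into exponential bounds, uniformly in the direction because badness is stable
under changes of the angle by r^N.  A typical sequence then has few bad blocks,
and the masses of projected intervals multiply along the good ones, so a mass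
distribution argument gives dim pi_beta mu >= t- for all beta at once.  No
separation condition is used. *)

Require Import Defs.
From HB Require Import structures.
From mathcomp Require Import all_boot all_order all_algebra.
From mathcomp Require Import all_classical all_reals all_analysis.
From mathcomp Require Import measurable_realfun.
From mathcomp Require Import ring lra zify.
Import Order.TTheory GRing.Theory Num.Theory.
Import numFieldNormedType.Exports.
Local Open Scope classical_set_scope.
Local Open Scope ring_scope.

Set Implicit Arguments.
Unset Strict Implicit.
Unset Printing Implicit Defensive.

(* MathComp-Analysis has another [edist]. *)
Local Notation edist := Defs.edist.

(** * Finite words with independent letters *)

(** The obstacle is that direction and environment move together: block k is seen in direction b - k
    N theta and through the k-th stretch of the random environment, so the orbit average cannot be
    taken along the actual sequence. It is taken with the environment of a single block frozen.
    Integrating then bounds the sum over k of the probabilities of badness in the k-th direction;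
    such a sum depends only on the law of one block, so each term can be transferred to the k-th
    independent block. Exponential estimates are therefore made twice: over environments, for the
    proportion of blocks in which too many words are bad, and, in a fixed environment, over words.
    Directions enter through the net of multiples of r^N, with one almost sure event for each.
    Weighting a word by rho to the number of its bad blocks makes the bound on balls multiplicative;
    if at most a proportion 1/M of the blocks is bad, removing the weight costs a factor rho^(-1/M)
    per block. Estimates are made on finite words, where measurability is elementary; infinite
    sequences return in the passage to Hausdorff dimension. *)

Section WordExpectation.
Context {R : realFieldType} {T : finType}.
Implicit Types (p q : nat -> T -> R) (w u v : seq T) (F G : seq T -> R).

(* Expectation of F over words of length k whose letters are independent, the
   j-th one having law p j. *)
Fixpoint Ex p k F : R :=
  if k is k'.+1 then \sum_i p 0 i * Ex (fun j => p j.+1) k' (fun w => F (i :: w))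
  else F [::].

Fixpoint mass p w : R :=
  if w is i :: w' then p 0 i * mass (fun j => p j.+1) w' else 1.

Definition shp p k : nat -> T -> R := fun j => p (k + j)%N.

Definition pvec p := forall j, (forall i, 0 <= p j i) /\ \sum_i p j i = 1.

Lemma pvec_shp p k : pvec p -> pvec (shp p k).
Proof. by move=> hp j; exact: hp. Qed.

Lemma shp_shp p k l : shp (shp p k) l =1 shp p (k + l).
Proof. by move=> j; rewrite /shp addnA. Qed.

Lemma Ex_cat p k l F :
  Ex p (k + l) F = Ex p k (fun w => Ex (shp p k) l (fun u => F (w ++ u))).
Proof.
elim: k p F => [//|k IH] p F; rewrite addSn /=.
by apply: eq_bigr => i _; rewrite IH.
Qed.

Lemma eq_Ex_pF p q k F G :
  (forall j i, (j < k)%N -> p j i = q j i) -> (forall w, size w = k -> F w = G w) ->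
  Ex p k F = Ex q k G.
Proof.
elim: k p q F G => [|k IH] p q F G hpq hFG /=; first exact: hFG.
apply: eq_bigr => i _; rewrite hpq//; congr (_ * _).
by apply: IH => [j i' jk|w sw]; [exact: hpq|apply: hFG; rewrite /= sw].
Qed.

Lemma eq_Ex p k F G : (forall w, size w = k -> F w = G w) -> Ex p k F = Ex p k G.
Proof. by move=> h; apply: eq_Ex_pF. Qed.

Lemma eq_Exp p q k F : (forall j i, (j < k)%N -> p j i = q j i) -> Ex p k F = Ex q k F.
Proof. by move=> h; apply: eq_Ex_pF. Qed.

Lemma le_Ex p k F G : pvec p ->
  (forall w, size w = k -> F w <= G w) -> Ex p k F <= Ex p k G.
Proof.
elim: k p F G => [|k IH] p F G hp hFG /=; first exact: hFG.
apply: ler_sum => i _; apply: ler_wpM2l; first exact: (hp 0%N).1.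
apply: IH => [j|w sw]; first exact: hp.
by apply: hFG; rewrite /= sw.
Qed.

Lemma Ex_cst p k (c : R) : pvec p -> Ex p k (fun=> c) = c.
Proof.
elim: k p => [//|k IH] p hp /=.
under eq_bigr do rewrite (IH (fun j => p j.+1) (fun j => hp j.+1)).
by rewrite -mulr_suml (hp 0%N).2 mul1r.
Qed.

Lemma Ex_ge0 p k F : pvec p -> (forall w, size w = k -> 0 <= F w) -> 0 <= Ex p k F.
Proof. by move=> hp h; rewrite -(Ex_cst k 0 hp); apply: le_Ex. Qed.

Lemma Ex_le_cst p k F c : pvec p ->
  (forall w, size w = k -> F w <= c) -> Ex p k F <= c.
Proof. by move=> hp h; rewrite -[leRHS](Ex_cst k c hp); apply: le_Ex. Qed.

Lemma ExD p k F G : Ex p k (fun w => F w + G w) = Ex p k F + Ex p k G.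
Proof.
elim: k p F G => [//|k IH] p F G /=.
rewrite -big_split /=; apply: eq_bigr => i _.
by rewrite (IH _ (fun w => F (i :: w)) (fun w => G (i :: w))) mulrDr.
Qed.

Lemma ExZ p k c F : Ex p k (fun w => c * F w) = c * Ex p k F.
Proof.
elim: k p F => [//|k IH] p F /=.
rewrite mulr_sumr; apply: eq_bigr => i _.
by rewrite (IH _ (fun w => F (i :: w))) mulrCA.
Qed.

Lemma Ex_sum p k (I : Type) (s : seq I) (P : pred I) (F : I -> seq T -> R) :
  Ex p k (fun w => \sum_(x <- s | P x) F x w) = \sum_(x <- s | P x) Ex p k (F x).
Proof.
elim: s => [|x s IH].
  under eq_Ex do rewrite big_nil.
  rewrite big_nil -[RHS](mul0r (Ex p k (fun=> 0))) -ExZ.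
  by apply: eq_Ex => w _; rewrite mul0r.
rewrite big_cons -IH; case: ifPn => Px; last first.
  by apply: eq_Ex => w _; rewrite big_cons (negbTE Px).
by rewrite -ExD; apply: eq_Ex => w _; rewrite big_cons Px.
Qed.


(** The last l letters integrate to 1. This lets conditions on prefixes of different lengths be
    compared under one expectation. *)
Lemma Ex_take p k l F : pvec p -> Ex p (k + l) (fun w => F (take k w)) = Ex p k F.
Proof.
move=> hp; rewrite Ex_cat; apply: eq_Ex => w sw.
rewrite (@eq_Ex _ _ _ (fun=> F w)); first by rewrite Ex_cst//; exact: pvec_shp.
by move=> u _; rewrite -sw take_size_cat.
Qed.

Lemma mass_ge0 p w : pvec p -> 0 <= mass p w.
Proof.
elim: w p => [|i w IH] p hp /=; first exact: ler01.
by apply: mulr_ge0; [exact: (hp 0%N).1|apply: IH => j; exact: hp].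
Qed.

Lemma mass_le_Ex p k w F : pvec p -> (forall w, 0 <= F w) -> size w = k ->
  mass p w * F w <= Ex p k F.
Proof.
elim: k w p F => [|k IH] [|i w] p F hp F0 //=; first by rewrite mul1r.
move=> [sw]; rewrite (bigD1 i)//= -mulrA.
apply: ler_wpDr.
  apply: sumr_ge0 => j _; apply: mulr_ge0; first exact: (hp 0%N).1.
  by apply: Ex_ge0 => // j'; exact: hp.
apply: ler_wpM2l; first exact: (hp 0%N).1.
by apply: (IH w _ (fun w => F (i :: w))) => // j; exact: hp.
Qed.

(** There are [#|T| ^ k] words, and each word counted contributes its mass, which is below c. *)
Lemma Ex_small_mass p k (c : R) : pvec p -> 0 <= c ->
  Ex p k (fun w => (mass p w < c)%R%:R) <= c * #|T|%:R ^+ k.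
Proof.
elim: k p c => [|k IH] p c hp c0 /=.
  by rewrite expr0 mulr1; case: ltP => //= h; exact: ltW.
have -> : c * #|T|%:R ^+ k.+1 = \sum_(i : T) (c * #|T|%:R ^+ k).
  by rewrite sumr_const -[RHS]mulr_natl exprS mulrCA.
apply: ler_sum => i _.
have h0 : 0 <= c * #|T|%:R ^+ k by rewrite mulr_ge0// exprn_ge0.
have [pi0|] := eqVneq (p 0%N i) 0; first by rewrite pi0 mul0r.
(* For a first letter of positive probability the rest of the word has mass below c divided by that
   probability, and the quotient cancels against the weight of the letter. *)
move=> pin; have pi0 : 0 < p 0%N i by rewrite lt_def pin (hp 0%N).1.
rewrite -ler_pdivlMl// mulrA.
apply: le_trans (IH (fun j => p j.+1) ((p 0%N i)^-1 * c) _ _); last 2 first.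
- by move=> j; exact: hp.
- by rewrite mulr_ge0// invr_ge0 ltW.
- by apply: le_Ex => [j|w _]; [exact: hp|rewrite ltr_pdivlMl].
Qed.

End WordExpectation.

(** * Plane geometry *)

Section PlaneGeometry.
Context {R : realType}.
Implicit Types (x y z b c t : R) (u v w : R * R).

Lemma sin_lipschitz x y : `|sin x - sin y| <= `|x - y|.
Proof.
wlog xy : x y / y < x => [hw|].
  by case: (ltgtP x y) => [h|h|->]; [rewrite distrC (distrC x)| |rewrite !subrr]; auto.
have [|z _ ->] := @MVT R sin cos y x xy (fun z _ => is_derive_sin z).
  by apply: continuous_subspaceT => z; exact: continuous_sin.
by rewrite normrM ler_piMl// cos_max.
Qed.

Lemma cos_lipschitz x y : `|cos x - cos y| <= `|x - y|.
Proof.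
rewrite -!sinDpihalf; apply: le_trans (sin_lipschitz _ _) _.
by rewrite opprD addrACA subrr addr0.
Qed.

(** The derivative is at least 1/2 on [0, 1], because cos z = 1 - 2 sin(z/2)^2 and |sin(z/2)| <= 1/2
    there. *)
Lemma sin_ge_half x : 0 <= x <= 1 -> x / 2 <= sin x.
Proof.
case/andP=> x0 x1; have [->|xn0] := eqVneq x 0; first by rewrite mul0r sin0.
have {xn0}x0 : 0 < x by rewrite lt_def xn0.
have [|z] := @MVT R sin cos 0 x x0 (fun z _ => is_derive_sin z).
  by apply: continuous_subspaceT => z; exact: continuous_sin.
rewrite in_itv/= sin0 !subr0 => /andP[z0 zx] ->.
have hs : `|sin (z / 2)| <= z / 2.
  have := sin_lipschitz (z / 2) 0; rewrite sin0 !subr0 => /le_trans; apply.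
  by rewrite ger0_norm// divr_ge0// ltW.
have hc : cos z = 1 - 2 * sin (z / 2) ^+ 2.
  have -> : cos z = cos ((z / 2) *+ 2) by congr cos; lra.
  by rewrite cos_mulr2n cos2sin2; lra.
have h2 : sin (z / 2) ^+ 2 <= (z / 2) ^+ 2.
  by rewrite -[leLHS]real_normK ?num_real// lerXn2r// ?nnegrE// divr_ge0// ltW.
have hc2 : 1 / 2 <= cos z.
  have : (z / 2) ^+ 2 <= 1 / 4 by nra.
  by rewrite hc; lra.
by nra.
Qed.

Definition nrm v := Num.sqrt (v.1 ^+ 2 + v.2 ^+ 2).
(** [proj_line b v] is a point of the plane; this is its signed coordinate along the line, and
    [edist_proj_line] shows that distances agree. *)
Definition prj b v : R := v.1 * cos b + v.2 * sin b.

Lemma nrm_ge0 v : 0 <= nrm v. Proof. exact: sqrtr_ge0. Qed.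

Lemma nrm2 v : nrm v ^+ 2 = v.1 ^+ 2 + v.2 ^+ 2.
Proof. by rewrite sqr_sqrtr// addr_ge0 ?sqr_ge0. Qed.

Lemma nrm_le v c : 0 <= c -> v.1 ^+ 2 + v.2 ^+ 2 <= c ^+ 2 -> nrm v <= c.
Proof. by move=> c0 h; rewrite -ler_sqr ?nnegrE ?nrm_ge0// nrm2. Qed.

Lemma nrm_dot u v : u.1 * v.1 + u.2 * v.2 <= nrm u * nrm v.
Proof.
have [h|h] := lerP (u.1 * v.1 + u.2 * v.2) 0.
  by apply: le_trans h _; rewrite mulr_ge0 ?nrm_ge0.
rewrite -ler_sqr ?nnegrE ?mulr_ge0 ?nrm_ge0//; last exact: ltW.
rewrite exprMn !nrm2 -subr_ge0.
by have := sqr_ge0 (u.1 * v.2 - u.2 * v.1); lra.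
Qed.

Lemma edist2E u v : edist u v = nrm (u.1 - v.1, u.2 - v.2). Proof. by []. Qed.

Lemma edist2_ge0 u v : 0 <= edist u v. Proof. exact: sqrtr_ge0. Qed.

Lemma edist2C u v : edist u v = edist v u.
Proof. by rewrite /edist -(sqrrN (u.1 - v.1)) -(sqrrN (u.2 - v.2)) !opprB. Qed.

Lemma edist2xx u : edist u u = 0.
Proof. by rewrite /edist !subrr expr0n/= addr0 sqrtr0. Qed.

Lemma edist2_triangle v u w : edist u w <= edist u v + edist v w.
Proof.
rewrite (edist2E u w); apply: nrm_le; first by rewrite addr_ge0 ?edist2_ge0.
rewrite [leRHS]sqrrD !edist2E !nrm2 /=.
by have := nrm_dot (u.1 - v.1, u.2 - v.2) (v.1 - w.1, v.2 - w.2); rewrite /=; lra.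
Qed.

Lemma edist2_le_sum u v : edist u v <= `|u.1 - v.1| + `|u.2 - v.2|.
Proof.
rewrite edist2E; apply: nrm_le => /=; first by rewrite addr_ge0.
rewrite [leRHS]sqrrD !real_normK ?num_real// -subr_ge0.
have : 0 <= `|u.1 - v.1| * `|u.2 - v.2| by rewrite mulr_ge0.
by lra.
Qed.

Lemma edist2_ge1 u v : `|u.1 - v.1| <= edist u v.
Proof.
rewrite -ler_sqr ?nnegrE ?edist2_ge0// edist2E nrm2 real_normK ?num_real//=.
by rewrite ler_wpDr// sqr_ge0.
Qed.

Lemma edist2_ge2 u v : `|u.2 - v.2| <= edist u v.
Proof.
rewrite -ler_sqr ?nnegrE ?edist2_ge0// edist2E nrm2 real_normK ?num_real//=.
by rewrite ler_wpDl// sqr_ge0.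
Qed.

Lemma prjB b u v : prj b u - prj b v = prj b (u.1 - v.1, u.2 - v.2).
Proof. by rewrite /prj /=; ring. Qed.

Lemma prj_le_nrm b v : `|prj b v| <= nrm v.
Proof.
rewrite -ler_sqr ?nnegrE ?nrm_ge0// nrm2 real_normK ?num_real// /prj.
rewrite -[leRHS]mulr1 -(cos2Dsin2 b) -subr_ge0.
by have := sqr_ge0 (v.1 * sin b - v.2 * cos b); lra.
Qed.

Lemma prj_lipschitz b u v : `|prj b u - prj b v| <= edist u v.
Proof. by rewrite prjB; exact: prj_le_nrm. Qed.

Lemma edist_proj_line b u v :
  edist (proj_line b u) (proj_line b v) = `|prj b u - prj b v|.
Proof.
rewrite /edist /proj_line /= -!/(prj b _) -!mulrBl !exprMn -mulrDr cos2Dsin2 mulr1.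
by rewrite sqrtr_sqr.
Qed.

Lemma prj_angle_lipschitz b c v : `|prj b v - prj c v| <= 2 * nrm v * `|b - c|.
Proof.
have -> : prj b v - prj c v = v.1 * (cos b - cos c) + v.2 * (sin b - sin c).
  by rewrite /prj; ring.
apply: le_trans (ler_normD _ _) _; rewrite !normrM.
have h1 : `|v.1| <= nrm v by have := edist2_ge1 v (0, 0); rewrite edist2E /= !subr0 -surjective_pairing.
have h2 : `|v.2| <= nrm v by have := edist2_ge2 v (0, 0); rewrite edist2E /= !subr0 -surjective_pairing.
have -> : 2 * nrm v * `|b - c| = nrm v * `|b - c| + nrm v * `|b - c| by ring.
by apply: lerD; apply: ler_pM => //; [exact: cos_lipschitz|exact: sin_lipschitz].
Qed.

(** Transversality: a vector nearly orthogonal to two directions is short unless the directions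
    nearly coincide modulo pi. *)
Lemma prj_sin b c v : `|sin (c - b)| * nrm v <= `|prj b v| + `|prj c v|.
Proof.
rewrite -ler_sqr ?nnegrE ?mulr_ge0 ?nrm_ge0 ?addr_ge0//.
rewrite exprMn nrm2 real_normK ?num_real// [leRHS]sqrrD !real_normK ?num_real//.
have e : sin (c - b) ^+ 2 * (v.1 ^+ 2 + v.2 ^+ 2) =
    prj b v ^+ 2 + prj c v ^+ 2 - 2 * (prj b v * prj c v) * cos (c - b).
  (* Cramer's rule recovers v from its coordinates in the directions b and c. *)
  have e1 : v.1 * sin (c - b) = prj b v * sin c - prj c v * sin b.
    by rewrite sinB /prj; ring.
  have e2 : v.2 * sin (c - b) = prj c v * cos b - prj b v * cos c.
    by rewrite sinB /prj; ring.
  have -> : sin (c - b) ^+ 2 * (v.1 ^+ 2 + v.2 ^+ 2) =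
    (v.1 * sin (c - b)) ^+ 2 + (v.2 * sin (c - b)) ^+ 2 by ring.
  rewrite e1 e2 cosB.
  have := cos2Dsin2 b; have := cos2Dsin2 c.
  move: (prj b v) (prj c v) (cos b) (cos c) (sin b) (sin c) => A B cb cc sb sc hc hb.
  have -> : (A * sc - B * sb) ^+ 2 + (B * cb - A * cc) ^+ 2 =
    A ^+ 2 * (cc ^+ 2 + sc ^+ 2) + B ^+ 2 * (cb ^+ 2 + sb ^+ 2)
    - 2 * (A * B) * (cc * cb + sc * sb) by ring.
  by rewrite hc hb !mulr1.
rewrite e.
have h : - (prj b v * prj c v * cos (c - b)) <= `|prj b v| * `|prj c v|.
  apply: le_trans (ler_norm _) _; rewrite normrN !normrM ler_piMr ?mulr_ge0//.
  exact: cos_max.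
by lra.
Qed.

End PlaneGeometry.

(** * Words as similarities, and the points that they code *)

Section IFS.
Context {R : realType} {n : nat} (r theta : R) (a : Lam n -> R * R).
Hypothesis hr : 0 < r < 1.
Implicit Types (w u : seq (Lam n)) (x y : R * R).

Let r0 : 0 < r. Proof. by case/andP: hr. Qed.
Let r1 : r < 1. Proof. by case/andP: hr. Qed.
Let rX k : 0 < r ^+ k. Proof. exact: exprn_gt0. Qed.

Definition wmap w x := foldr (ifs_map r theta a) x w.
Definition pt w := wmap w (0, 0).

Lemma wmap_cat w u x : wmap (w ++ u) x = wmap w (wmap u x).
Proof. exact: foldr_cat. Qed.

Lemma pt_cat w u : pt (w ++ u) = wmap w (pt u).
Proof. exact: wmap_cat. Qed.

(** Rotating the point by theta amounts to rotating the direction by -theta. Iterated along a word,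
    this produces the orbit b - k theta. *)
Lemma prj_ifs_map b i x :
  prj b (ifs_map r theta a i x) = prj b (a i) + r * prj (b - theta) x.
Proof. by rewrite /prj /ifs_map /rot /= cosB sinB; ring. Qed.

Lemma prj_wmap b w x :
  prj b (wmap w x) = prj b (pt w) + r ^+ size w * prj (b - (size w)%:R * theta) x.
Proof.
elim: w b => [|i w IH] b.
  have -> : b - (size (@nil (Lam n)))%:R * theta = b by rewrite mulr0n mul0r subr0.
  by rewrite /pt /= /prj /= expr0; ring.
rewrite /pt /= !prj_ifs_map IH /pt exprS -addn1 natrD.
have -> : b - theta - (size w)%:R * theta = b - ((size w)%:R + 1) * theta by ring.
by ring.
Qed.

Lemma prj_pt_cat b w u :
  prj b (pt (w ++ u)) = prj b (pt w) + r ^+ size w * prj (b - (size w)%:R * theta) (pt u).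
Proof. by rewrite pt_cat prj_wmap. Qed.

Lemma edist_ifs_map i x y :
  edist (ifs_map r theta a i x) (ifs_map r theta a i y) = r * edist x y.
Proof.
rewrite /edist /ifs_map /rot /=.
rewrite -[r in RHS]ger0_norm ?ltW// -sqrtr_sqr -sqrtrM ?sqr_ge0//; congr Num.sqrt.
rewrite -[X in _ = _ * X]mulr1 -(cos2Dsin2 theta); ring.
Qed.

Lemma edist_wmap w x y : edist (wmap w x) (wmap w y) = r ^+ size w * edist x y.
Proof.
elim: w => [|i w IH] /=; first by rewrite expr0 mul1r.
by rewrite edist_ifs_map IH exprS mulrA.
Qed.

(** A radius D with |a_i| + r D <= D for every i, so that the disc of radius D about 0 is mapped
    into itself; the summand 1 gives D >= 1. *)
Definition ptbound : R := (\sum_i nrm (a i) + 1) / (1 - r).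
Local Notation D := ptbound.

Lemma ptbound_ge1 : 1 <= D.
Proof.
rewrite /D ler_pdivlMr ?subr_gt0// mul1r.
have : 0 <= \sum_i nrm (a i) by apply: sumr_ge0 => i _; exact: nrm_ge0.
by have := r0; lra.
Qed.

Lemma edist_pt w : edist (0, 0) (pt w) <= D.
Proof.
elim: w => [|i w IH]; first by rewrite /pt /= edist2xx (le_trans _ ptbound_ge1).
rewrite {1}/pt /= -/(pt w).
apply: le_trans (edist2_triangle (ifs_map r theta a i (0, 0)) _ _) _.
rewrite edist_ifs_map.
have -> : ifs_map r theta a i (0, 0) = a i.
  by rewrite /ifs_map /rot /= !mulr0 subrr addr0 mulr0 !add0r -surjective_pairing.
have -> : edist (0, 0) (a i) = nrm (a i).
  by rewrite edist2C edist2E /= !subr0 -surjective_pairing.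
have h : nrm (a i) <= \sum_i nrm (a i).
  rewrite (bigD1 i)//= lerDl sumr_ge0// => j _; exact: nrm_ge0.
have h2 : D * (1 - r) = \sum_i nrm (a i) + 1.
  by rewrite /D -mulrA mulVf ?mulr1// subr_eq0 eq_sym lt_eqF.
have : r * edist (0, 0) (pt w) <= r * D by rewrite ler_pM2l.
by lra.
Qed.

Lemma nrm_pt w : nrm (pt w) <= D.
Proof. by have := edist_pt w; rewrite edist2C edist2E /= !subr0 -surjective_pairing. Qed.

Lemma edist_pt_cat w u : edist (pt w) (pt (w ++ u)) <= D * r ^+ size w.
Proof. by rewrite pt_cat edist_wmap mulrC ler_pM2r// edist_pt. Qed.

Lemma edist_pt_take w k : (k <= size w)%N -> edist (pt (take k w)) (pt w) <= D * r ^+ k.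
Proof.
move=> kw; have := edist_pt_cat (take k w) (drop k w).
by rewrite cat_take_drop size_takel.
Qed.

Lemma ifs_comp_mkseq (s : nat -> Lam n) k x :
  ifs_comp r theta a s k x = wmap (mkseq s k) x.
Proof.
elim: k x => [//|k IH] x.
by rewrite mkseqS /wmap foldr_rcons; exact: IH.
Qed.

End IFS.

(** * Equidistribution of the orbit of angles *)

Lemma sum_shift_le (V : nat -> bool) (m n : nat) :
  (\sum_(0 <= k < n) V k <= \sum_(0 <= k < n) V (k + m) + m)%N.
Proof.
apply: (@leq_trans (\sum_(0 <= k < n + m) V k)%N).
  by rewrite [X in (_ <= X)%N](@big_cat_nat _ _ _ n)//= ?leq_addr// leq_addr.
rewrite (@big_cat_nat _ _ _ m)//= ?leq_addl// addnC leq_add//.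
  by rewrite -{1}[m]add0n big_addn addnK.
apply: (@leq_trans (\sum_(0 <= k < m) 1)%N).
  by apply: leq_sum => k _; case: (V k).
by rewrite sum_nat_const_nat subn0 muln1.
Qed.

(* Each window k, k + Q, ..., k + (K - 1) Q meets V at most once. *)
Lemma sum_sparse_le (V : nat -> bool) (K Q n : nat) :
  (forall k i, (0 < i < K)%N -> V k -> V (k + i * Q)%N -> False) ->
  (K * \sum_(0 <= k < n) V k <= n + K * (K * Q))%N.
Proof.
move=> hV.
have one k : (\sum_(i < K) V (k + i * Q)%N <= 1)%N.
  have [[i Vi]|/forallNP hn] := pselect (exists i : 'I_K, V (k + i * Q)%N); last first.
    by rewrite big1// => i _; apply/eqP; rewrite eqb0; apply/negP; exact: hn.
  rewrite (bigD1 i)//= Vi big1// => j ji; apply/eqP; rewrite eqb0; apply/negP => Vj.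
  have [ij|ji'] := ltnP i j.
    apply: (hV _ (j - i)%N _ Vi); first by rewrite subn_gt0 ij/=; have := ltn_ord j; lia.
    by rewrite -addnA -mulnDl subnKC// ltnW.
  have {}ji : (j < i)%N by rewrite ltn_neqAle ji' andbT; exact: ji.
  apply: (hV _ (i - j)%N _ Vj); first by rewrite subn_gt0 ji/=; have := ltn_ord i; lia.
  by rewrite -addnA -mulnDl subnKC// ltnW.
rewrite -{1}(card_ord K) -sum_nat_const.
apply: (@leq_trans (\sum_(i < K) (\sum_(0 <= k < n) V (k + i * Q)%N + K * Q))%N).
  apply: leq_sum => i _; apply: leq_trans (sum_shift_le V (i * Q) n) _.
  by rewrite leq_add2l leq_mul2r ltnW ?orbT.
rewrite big_split /= sum_nat_const card_ord leq_add2r exchange_big/=.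
apply: (@leq_trans (\sum_(0 <= k < n) 1)%N); first by apply: leq_sum => k _; exact: one.
by rewrite sum_nat_const_nat subn0 muln1.
Qed.

Section Equidistribution.
Context {R : realType}.
Implicit Types (x phi b e t : R).

Lemma norm_sin_addpi x (m : int) : `|sin (x + m%:~R * pi)| = `|sin x|.
Proof.
have hn (y : R) (k : nat) : `|sin (y + k%:R * pi)| = `|sin y|.
  by rewrite mulr_natl (alternatingn (@sinDpi R) k y) normrM normrX normrN1 expr1n mul1r.
case: m => k; first exact: hn.
by rewrite -(hn _ k.+1) NegzE rmorphN/= mulNr subrK.
Qed.

(** Pigeonhole: among the fractional parts of the multiples of x by 0, ..., M+1, two fall into the
    same interval of length 1/(M+1). *)
Lemma dirichlet_approx x (M : nat) : exists (q : nat) (p : int),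
  (0 < q)%N /\ `|q%:R * x - p%:~R| < M.+1%:R^-1.
Proof.
pose fr (k : nat) : R := k%:R * x - (Num.floor (k%:R * x))%:~R.
have fr0 k : 0 <= fr k by rewrite subr_ge0 floor_le_tmp.
have fr1 k : fr k < 1 by rewrite ltrBlDl -intrD1 floorD1_gt.
have h0 k : 0 <= M.+1%:R * fr k by rewrite mulr_ge0.
have tr k : (Num.truncn (M.+1%:R * fr k) < M.+1)%N.
  have /andP[h1 h2] := truncn_itv (h0 k).
  rewrite -(ltr_nat R); apply: le_lt_trans h1 _.
  by rewrite -[ltRHS]mulr1 ltr_pM2l.
pose f (k : 'I_M.+2) : 'I_M.+1 := Ordinal (tr k).
have /injectivePn[k1 [k2 k12 fk]] : ~~ injectiveb f.
  apply/injectiveP => finj; have := leq_card f finj.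
  by rewrite !card_ord ltnn.
have key i j : (i < j)%N -> Num.truncn (M.+1%:R * fr i) = Num.truncn (M.+1%:R * fr j) ->
    exists (q : nat) (p : int), (0 < q)%N /\ `|q%:R * x - p%:~R| < M.+1%:R^-1.
  move=> ij e; exists (j - i)%N, (Num.floor (j%:R * x) - Num.floor (i%:R * x)).
  split; first by rewrite subn_gt0.
  rewrite natrB; last exact: ltnW.
  rewrite mulrzBr.
  have -> : (j%:R - i%:R) * x - ((Num.floor (j%:R * x))%:~R - (Num.floor (i%:R * x))%:~R) =
    fr j - fr i by rewrite /fr; ring.
  have /andP[h1 h2] := truncn_itv (h0 i); have /andP[h3 h4] := truncn_itv (h0 j).
  rewrite -(ltr_pM2l (ltr0Sn R M)) divff ?pnatr_eq0//.
  rewrite -[X in X * `|_|]ger0_norm// -normrM mulrBr ltr_norml.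
  move: h1 h2 h3 h4; rewrite e -addn1 natrD; lra.
have e : Num.truncn (M.+1%:R * fr k1) = Num.truncn (M.+1%:R * fr k2) by have := congr1 val fk.
have [h|h|h] := ltngtP k1 k2; first exact: (key k1 k2).
- exact: (key k2 k1).
- by move/eqP: k12; case; exact: val_inj.
Qed.

Variable phi : R.
Hypothesis phi_irr : forall (q : nat) (p : int), (0 < q)%N -> q%:R * phi <> p%:~R * pi.

(** Dirichlet gives q with q phi = tau modulo pi and 0 < |tau| < 4 eta, where irrationality excludes
    tau = 0. A multiple l brings l |tau| into (4 eta, 8 eta]. With Q = l q and K the integer part of
    1/(8 eta), the angles i l |tau| for 0 < i < K lie in (4 eta, 1], where sin x >= x/2. *)
Lemma separated_multiples (eta : R) : 0 < eta <= 16^-1 -> exists Q K : nat,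
  [/\ (0 < K)%N, 1 <= 16 * eta * K%:R &
      forall i, (0 < i < K)%N -> 2 * eta < `|sin ((i * Q)%:R * phi)|].
Proof.
case/andP=> e0 e1; have pi0 := pi_gt0 R.
pose M := Num.truncn (pi / (4 * eta)).
have hM : pi < M.+1%:R * (4 * eta).
  by rewrite -ltr_pdivrMr ?mulr_gt0//; apply: truncnS_gt.
have [q [p [q0 hqp]]] := dirichlet_approx (phi / pi) M.
pose tau := q%:R * phi - p%:~R * pi.
have tau0 : 0 < `|tau| by rewrite normr_gt0 subr_eq0; apply/eqP; exact: phi_irr.
have tau1 : `|tau| < 4 * eta.
  have -> : tau = (q%:R * (phi / pi) - p%:~R) * pi by rewrite mulrBl -mulrA divfK ?gt_eqF.
  rewrite normrM (gtr0_norm pi0) -ltr_pdivlMr//.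
  apply: lt_trans hqp _.
  by rewrite -div1r ltr_pdivrMr// mulrC mulrA ltr_pdivlMr// mul1r.
pose l := (Num.truncn (4 * eta / `|tau|)).+1.
have /andP[l1 l2] : ((l.-1)%:R <= 4 * eta / `|tau| < l%:R).
  by apply: truncn_itv; rewrite divr_ge0// mulr_ge0// ltW.
have {l2} l2 : 4 * eta < l%:R * `|tau| by rewrite -ltr_pdivrMr.
have {l1} l1 : l%:R * `|tau| <= 8 * eta.
  move: l1; rewrite ler_pdivlMr// => l1.
  have -> : l%:R = (l.-1)%:R + 1 :> R by rewrite -natr1.
  by lra.
pose K := Num.truncn ((8 * eta)^-1).
have e8 : 0 < 8 * eta by rewrite mulr_gt0.
have /andP[k1 k2] : K%:R <= (8 * eta)^-1 < K.+1%:R.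
  by apply: truncn_itv; rewrite invr_ge0 ltW.
have {}k1 : K%:R * (8 * eta) <= 1 by rewrite -ler_pdivlMr// div1r.
have {}k2 : 1 < K.+1%:R * (8 * eta) by rewrite -ltr_pdivrMr// div1r.
have K0 : (0 < K)%N.
  rewrite lt0n; apply/eqP => K0; move: k2; rewrite K0 mul1r; lra.
exists (l * q)%N, K; split => //.
  have : 1 <= K%:R :> R by rewrite ler1n.
  by move: k2; rewrite -natr1; nra.
move=> i /andP[i0 iK].
have -> : (i * (l * q))%:R * phi = (i * l)%:R * tau + ((i * l)%:Z * p)%:~R * pi.
  by rewrite /tau intrM -pmulrn !natrM; ring.
rewrite norm_sin_addpi.
have -> : `|sin ((i * l)%:R * tau)| = `|sin ((i * l)%:R * `|tau|)|.
  by case: (ger0P tau) => _ //; rewrite mulrN sinN normrN.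
have i1 : 1 <= i%:R :> R by rewrite ler1n.
have iK' : i%:R <= K%:R :> R by rewrite ler_nat ltnW.
have hle : l%:R * `|tau| <= (i * l)%:R * `|tau|.
  by rewrite natrM -mulrA ler_peMl// mulr_ge0.
have hle1 : (i * l)%:R * `|tau| <= 1.
  by rewrite natrM -mulrA; apply: le_trans k1; apply: ler_pM.
apply: lt_le_trans (ler_norm _).
apply: lt_le_trans (sin_ge_half _); first by lra.
by rewrite hle1 andbT; lra.
Qed.

(** Two visits at times k and k + i Q would make |sin(i Q phi)| at most 2 eta by [prj_sin], so
    visits are sparse along steps of Q. The error [q0] depends on [eta] and phi, but not on the
    starting angle, the vector or the length of the orbit. *)
Lemma equidistribution (eta : R) : 0 < eta -> exists q0 : nat,
  forall (n : nat) b (v : R * R) e, 0 < nrm v -> e <= eta * nrm v ->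
  (\sum_(0 <= k < n) (`|prj (b - k%:R * phi) v| <= e)%R)%:R <= 16 * eta * n%:R + q0%:R.
Proof.
move=> e0; have [e16|e16] := lerP eta 16^-1; last first.
  exists 0%N => n b v e _ _; rewrite addr0.
  apply: (@le_trans _ _ n%:R).
    rewrite ler_nat; apply: (@leq_trans (\sum_(0 <= k < n) 1)%N).
      by apply: leq_sum => k _; case: (_ <= e)%R.
    by rewrite sum_nat_const_nat subn0 muln1.
  by rewrite ler_peMl//; lra.
have [|Q [K [K0 K1 hK]]] := @separated_multiples eta; first by rewrite e0.
exists (K * Q)%N => n b v e v0 ve.
set V := fun k : nat => (`|prj (b - k%:R * phi) v| <= e)%R.
have /= h := @sum_sparse_le V K Q n.
have {}h : (K * \sum_(0 <= k < n) V k <= n + K * (K * Q))%N.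
  apply: h => k i iK Vk Vki.
  have := hK i iK; rewrite ltNge => /negP; apply.
  rewrite -(ler_pM2r v0).
  have := prj_sin (b - (k + i * Q)%:R * phi) (b - k%:R * phi) v.
  have -> : b - k%:R * phi - (b - (k + i * Q)%:R * phi) = (i * Q)%:R * phi.
    by rewrite natrD; ring.
  move=> /le_trans; apply.
  by move: Vk Vki; rewrite /V => h1 h2; lra.
have {}h : K%:R * (\sum_(0 <= k < n) V k)%:R <= n%:R + K%:R * (K * Q)%:R :> R.
  by rewrite -!natrM -natrD ler_nat.
rewrite -/V.
have K0' : 0 < K%:R :> R by rewrite ltr0n.
rewrite -(ler_pM2l K0') mulrDr; apply: le_trans h _.
rewrite lerD2r mulrA (mulrC K%:R) ler_peMl//.
Qed.

End Equidistribution.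

(** * Heavy discs and bad words *)

Section Densities.
Context {R : realType} {n : nat} (r theta : R) (a : Lam n -> R * R).
Hypothesis hr : 0 < r < 1.
Implicit Types (w u : seq (Lam n)) (x y : R * R) (p : nat -> Lam n -> R).

Let r0 : 0 < r. Proof. by case/andP: hr. Qed.
Let r1 : r < 1. Proof. by case/andP: hr. Qed.
Let rX k : 0 < r ^+ k. Proof. exact: exprn_gt0. Qed.
Local Notation D := (ptbound r a).
Local Notation pt := (pt r theta a).

(* dens p j w is the mass of a disc of radius comparable to r^j around pt w,
   seen at level j; slab is its one-dimensional analogue for the projection in
   direction b. *)
Definition dens p j w : R :=
  Ex p j (fun w' => (edist (pt w) (pt w') <= (2 * D + 1) * r ^+ j)%R%:R).
Definition heavy (t : R) p j w : bool := r `^ (j%:R * t) < dens p j w.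
Definition heavy_mass (t : R) p j : R := Ex p j (fun w => (heavy t p j w)%:R).

Definition slab (kappa b : R) N p u : R :=
  Ex p N (fun u' => (`|prj b (pt u) - prj b (pt u')| <= kappa * r ^+ N)%R%:R).
Definition bad_word (kappa rho b : R) N p u : bool := rho < slab kappa b N p u.
Definition bad_word_mass (kappa rho b : R) N p : R :=
  Ex p N (fun u => (bad_word kappa rho b N p u)%:R).

(** Truncating both words to length k moves each point by at most D r^k, hence the radius (2D + 1)
    r^k in [dens]. *)
Lemma dens_ball p k j u : pvec p -> (k <= j)%N -> size u = j ->
  Ex p j (fun u' => (edist (pt u) (pt u') <= r ^+ k)%R%:R) <= dens p k (take k u).
Proof.
move=> hp kj su; rewrite /dens -(Ex_take k (j - k)) // subnKC//.
apply: le_Ex => // u' su'; rewrite ler_nat.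
case: (leP (edist (pt u) (pt u'))) => [h|_]; last by case: (_ <= _).
rewrite lt0b mulrDl mul1r.
have h1 := edist_pt_take theta a hr (w := u) (k := k).
have h2 := edist_pt_take theta a hr (w := u') (k := k).
rewrite su su' in h1 h2.
have := edist2_triangle (pt u) (pt (take k u)) (pt (take k u')).
have := edist2_triangle (pt u') (pt u) (pt (take k u')).
by rewrite (edist2C (pt u') (pt (take k u'))); move: (h1 kj) (h2 kj); lra.
Qed.

Lemma powr_le (s t : R) : s <= t -> r `^ t <= r `^ s.
Proof. by move=> st; apply: ger_powR => //; rewrite r0 ltW. Qed.

Lemma dens_fine t p k j u : pvec p -> (k <= j)%N -> size u = j ->
  ~~ heavy t p k (take k u) ->
  Ex p j (fun u' => (edist (pt u) (pt u') <= r ^+ k)%R%:R) <= r `^ (k%:R * t).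
Proof.
move=> hp kj su; rewrite /heavy -leNgt; apply: le_trans.
exact: dens_ball.
Qed.

Section Marstrand.
Variables (t kappa phi : R) (l L : nat).
Hypothesis t01 : 0 <= t <= 1.
Hypothesis kappa0 : 0 < kappa.
Hypothesis l0 : (0 < l)%N.
Hypothesis phi_irr : forall (q : nat) (m : int), (0 < q)%N -> q%:R * phi <> m%:~R * pi.
Local Notation N := (l * L)%N.
(** For i < l this is the ratio of the strip width kappa r^N to the distance r^((i+1)L), the
    relative width to which equidistribution applies. *)
Let eta (i : nat) : R := kappa * r ^+ (N - i.+1 * L).

(** Beyond distance r^N, sort the pair by the first i with r^((i+1)L) below its distance and apply
    [equidistribution] with [eta i]. Minimality bounds the distance by r^(iL), except at i = 0,
    where no upper bound is available; hence the disjunct. Pairs within r^N are counted at every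
    time. *)
Lemma count_le_scales : exists q0 : nat, forall k b u u',
  (\sum_(0 <= j < k)
     (`|prj (b - j%:R * phi) (pt u) - prj (b - j%:R * phi) (pt u')| <= kappa * r ^+ N)%R)%:R
  <= k%:R * (edist (pt u) (pt u') <= r ^+ N)%R%:R +
     \sum_(i < l) ((i == 0%N :> nat) || (edist (pt u) (pt u') <= r ^+ (i * L))%R)%:R *
        (16 * eta i * k%:R + q0%:R).
Proof.
have eta0 i : 0 < eta i by rewrite mulr_gt0.
have /choice[qf hq] := fun i : 'I_l => equidistribution phi_irr (eta0 i).
exists (\sum_i qf i)%N => k b u u'.
set d := edist (pt u) (pt u').
have term0 (i : 'I_l) : 0 <= ((i == 0%N :> nat) || (d <= r ^+ (i * L)))%:R *
    (16 * eta i * k%:R + (\sum_i qf i)%:R).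
  by rewrite mulr_ge0// addr_ge0// mulr_ge0// mulr_ge0// ltW.
have [dN|dN] := lerP d (r ^+ N).
  rewrite mulr1 -[leLHS]addr0 lerD ?sumr_ge0// ler_nat.
  apply: (@leq_trans (\sum_(0 <= j < k) 1)%N).
    by apply: leq_sum => j _; case: (_ <= _)%R.
  by rewrite sum_nat_const_nat subn0 muln1.
rewrite mulr0 add0r.
have ex : exists i, (i < l)%N && (r ^+ (i.+1 * L) < d).
  by exists l.-1; rewrite prednK// leqnn.
have [i0 /andP[i0l i0d] imin] := ex_minnP ex.
rewrite (bigD1 (Ordinal i0l))//=.
have -> : (i0 == 0%N) || (d <= r ^+ (i0 * L)).
  case: i0 imin i0l i0d => [//|i0] imin i0l i0d /=.
  rewrite leNgt; apply/negP => h.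
  by have := imin i0; rewrite h (ltn_trans _ i0l)// ltnn => /(_ isT).
rewrite mul1r -[leLHS]addr0 lerD ?sumr_ge0//.
have dE : d = nrm ((pt u).1 - (pt u').1, (pt u).2 - (pt u').2) by [].
have d0 : 0 < d by apply: lt_trans i0d.
under eq_bigr do rewrite prjB.
have := hq (Ordinal i0l) k b ((pt u).1 - (pt u').1, (pt u).2 - (pt u').2) (kappa * r ^+ N).
rewrite -dE => /(_ d0) h; apply: le_trans (h _) _ => {h}.
  rewrite /eta -mulrA ler_pM2l//=.
  apply: (@le_trans _ _ (r ^+ (N - i0.+1 * L) * r ^+ (i0.+1 * L))).
    by rewrite -exprD subnK// leq_mul2r i0l orbT.
  by rewrite ler_pM2l// ltW.
by rewrite /= lerD2l ler_nat (bigD1 (Ordinal i0l))//= leq_addr.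
Qed.

(* Marstrand's projection argument, with the orbit b - k phi as angle average. *)
Lemma sum_bad_mass_le : exists q0 : nat, forall p b rho k, pvec p -> 0 < rho ->
  \sum_(0 <= j < k) bad_word_mass kappa rho (b - j%:R * phi) N p <=
    k%:R * (\sum_(i < l) heavy_mass t p (i.+1 * L) +
            rho^-1 * ((1 + 16 * kappa * l%:R) * r `^ (N%:R * t - L%:R)))
    + rho^-1 * (l * q0)%:R.
Proof.
have [q0 hq] := count_le_scales; exists q0 => p b rho k hp rho0.
have rhoV : 0 < rho^-1 by rewrite invr_gt0.
case/andP: t01 => t0 t1.
pose fine (u : seq (Lam n)) := [forall i : 'I_l, ~~ heavy t p (i.+1 * L) (take (i.+1 * L) u)].
pose S b' u := slab kappa b' N p u.
have S0 b' u : 0 <= S b' u by apply: Ex_ge0.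
(* A bad word is heavy at one of the levels L, 2L, ..., lL, or it is charged to its slab by Markov's
   inequality. *)
have step1 b' u : (bad_word kappa rho b' N p u)%:R <=
    \sum_(i < l) (heavy t p (i.+1 * L) (take (i.+1 * L) u))%:R
    + rho^-1 * ((fine u)%:R * S b' u) :> R.
  have [/forallP hf|] := boolP (fine u).
    rewrite mul1r big1 ?add0r; last by move=> i _; rewrite (negbTE (hf i)).
    rewrite /bad_word; case: ltP => [h|_]; last by rewrite mulr_ge0// ltW.
    by rewrite mulrC ler_pdivlMr// mul1r ltW.
  rewrite negb_forall => /existsP[i]; rewrite negbK => hi.
  rewrite mul0r mulr0 addr0 (bigD1 i)//= hi.
  by case: bad_word => /=; rewrite ?lerDl ?addr_ge0 ?sumr_ge0//.
apply: (@le_trans _ _ (Ex p N (fun u => k%:R * \sum_(i < l)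
   (heavy t p (i.+1 * L) (take (i.+1 * L) u))%:R +
    rho^-1 * ((fine u)%:R * \sum_(0 <= j < k) S (b - j%:R * phi) u)))).
  rewrite -Ex_sum; apply: le_Ex => // u su.
  apply: (@le_trans _ _ (\sum_(0 <= j < k) (\sum_(i < l) (heavy t p (i.+1 * L) (take (i.+1 * L) u))%:R
    + rho^-1 * ((fine u)%:R * S (b - j%:R * phi) u)))).
    by apply: ler_sum => j _; exact: step1.
  rewrite big_split /= sumr_const_nat subn0 mulr_natl lerD2l.
  by rewrite -!mulr_sumr.
rewrite ExD ExZ mulrDr -addrA; apply: lerD.
  rewrite ler_wpM2l// Ex_sum; apply: ler_sum => i _.
  rewrite /heavy_mass -(Ex_take (i.+1 * L) (N - i.+1 * L) _ hp) subnKC//.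
  by rewrite leq_mul2r ltn_ord orbT.
rewrite ExZ mulrCA -mulrDr ler_pM2l//.
apply: Ex_le_cst => // u su.
have rhs0 : 0 <= k%:R * ((1 + 16 * kappa * l%:R) * r `^ (N%:R * t - L%:R)) + (l * q0)%:R.
  by rewrite addr_ge0// mulr_ge0// mulr_ge0 ?powR_ge0// addr_ge0// mulr_ge0// mulr_ge0// ltW.
have [/forallP fu|_] := boolP (fine u); last by rewrite mul0r.
rewrite mul1r /S /slab -Ex_sum.
have hfine (i : nat) : (0 < i <= l)%N ->
    Ex p N (fun u' => (edist (pt u) (pt u') <= r ^+ (i * L))%R%:R) <= r `^ ((i * L)%:R * t).
  move=> /andP[i0 il]; apply: dens_fine => //; first by rewrite leq_mul2r il orbT.
  have il' : (i.-1 < l)%N by rewrite prednK.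
  by have := fu (Ordinal il'); rewrite /= prednK.
apply: (@le_trans _ _ (Ex p N (fun u' => k%:R * (edist (pt u) (pt u') <= r ^+ N)%R%:R +
     \sum_(i < l) (16 * eta i * k%:R + q0%:R) *
       ((i == 0%N :> nat) || (edist (pt u) (pt u') <= r ^+ (i * L))%R)%:R))).
  apply: le_Ex => // u' su'; apply: le_trans (le_trans _ (hq k b u u')) _.
    by rewrite natr_sum.
  by rewrite lerD2l; apply: ler_sum => i _; rewrite mulrC.
rewrite ExD ExZ Ex_sum.
have -> : k%:R * ((1 + 16 * kappa * l%:R) * r `^ (N%:R * t - L%:R)) + (l * q0)%:R =
  k%:R * r `^ (N%:R * t - L%:R) +
   \sum_(i < l) (16 * kappa * k%:R * r `^ (N%:R * t - L%:R) + q0%:R).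
  by rewrite sumr_const card_ord -mulr_natl natrM; ring.
apply: lerD.
  rewrite ler_wpM2l//; apply: le_trans (hfine l _) _; first by rewrite l0/=.
  by apply: powr_le; rewrite gerBl.
apply: ler_sum => i _; rewrite ExZ.
have e0 : 0 <= 16 * eta i * k%:R + q0%:R.
  by rewrite addr_ge0// mulr_ge0// mulr_ge0// mulr_ge0// ltW.
pose m := r `^ ((i * L)%:R * t).
have m1 : m <= 1 by rewrite -(powRr0 r); apply: powr_le; rewrite mulr_ge0.
apply: (@le_trans _ _ ((16 * eta i * k%:R + q0%:R) * m)).
  rewrite ler_wpM2l//; have [i0|i0] := eqVneq (i : nat) 0%N.
    by rewrite /m i0 mul0n mul0r powRr0; apply: Ex_le_cst.
  by apply: hfine; rewrite lt0n i0 ltnW.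
rewrite mulrDl; apply: lerD; last by rewrite ler_piMr.
(* At scale i the relative width r^(N-(i+1)L) meets a disc of mass r^(iLt). The exponents add up to
   at least Nt - L, the excess being (N - iL)(1 - t), which is nonnegative as t <= 1. *)
rewrite /eta -!mulrA ler_pM2l// ler_pM2l// mulrCA ler_wpM2l//.
rewrite -powR_mulrn; last exact: ltW.
rewrite -powRD; last by rewrite (gt_eqF r0) implybT.
apply: powr_le.
have iN : (i.+1 * L <= N)%N by rewrite leq_mul2r ltn_ord orbT.
have iN' : (i * L)%:R <= N%:R :> R by rewrite ler_nat leq_mul2r ltnW ?orbT.
rewrite natrB// mulSn natrD; nra.
Qed.

End Marstrand.
End Densities.

(** * Mass estimates along blocks *)

Section Blocks.
Context {R : realType} {n : nat} (r theta : R) (a : Lam n -> R * R).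
Hypothesis hr : 0 < r < 1.
Variable N : nat.
Implicit Types (w u : seq (Lam n)) (p : nat -> Lam n -> R) (b x : R).

Let r0 : 0 < r. Proof. by case/andP: hr. Qed.
Let r1 : r < 1. Proof. by case/andP: hr. Qed.
Let rX k : 0 < r ^+ k. Proof. exact: exprn_gt0. Qed.
Local Notation D := (ptbound r a).
Local Notation pt := (pt r theta a).
Let D0 : 0 < D. Proof. exact: lt_le_trans (ptbound_ge1 a hr). Qed.

Section Bounds.
Variable rho : R.
Hypothesis rho0 : 0 < rho.
Local Notation bad := (bad_word r theta a (6 * D) rho).
Local Notation bad_mass := (bad_word_mass r theta a (6 * D) rho).

Fixpoint bad_count m b p w : nat :=
  if m is m'.+1 then
    (bad b N p (take N w) + bad_count m' (b - N%:R * theta) (shp p N) (drop N w))%N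
  else 0%N.

(** Two words projecting within 3D r^N of x are within 6D r^N of each other. So the slab of any one
    good word in reach contains all of them; this is why badness is defined with [6 * D]. *)
Lemma Ex_good_reach b p x : pvec p ->
  Ex p N (fun u => (`|prj b (pt u) - x| <= 3 * D * r ^+ N)%R%:R * (~~ bad b N p u)%:R) <= rho.
Proof.
move=> hp.
have [[u0 [su0 u0x u0b]]|hn] := pselect (exists u0, [/\ size u0 = N,
    `|prj b (pt u0) - x| <= 3 * D * r ^+ N & ~~ bad b N p u0]); last first.
  apply: Ex_le_cst => // u su.
  case: (lerP `|prj b (pt u) - x|) => [ux|_]; last by rewrite mul0r ltW.
  have [ub|ub] := boolP (bad b N p u); first by rewrite mulr0 ltW.
  by exfalso; apply: hn; exists u.
move: u0b; rewrite /bad_word -leNgt; apply: le_trans.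
apply: le_Ex => // u su.
case: (lerP `|prj b (pt u) - x|) => [ux|_]; last by rewrite mul0r.
rewrite mul1r ler_nat; apply: (@leq_trans 1); first by case: (~~ _).
rewrite lt0b; move: u0x ux; rewrite !ler_norml => /andP[h1 h2] /andP[h3 h4].
by apply/andP; split; lra.
Qed.

(* A first block outside the reach of the ball contributes nothing; a good
   block within reach costs rho by its mass, a bad one by its weight. *)
Lemma ball_weight_le m b p x : pvec p ->
  Ex p (m * N) (fun w => (`|prj b (pt w) - x| <= 2 * D * r ^+ (m * N))%R%:R
                          * rho ^+ bad_count m b p w) <= (2 * rho) ^+ m.
Proof.
have rhoge0 := ltW rho0; have rNge0 := ltW (rX N).
elim: m b p x => [|m IH] b p x hp.
  by rewrite mul0n /= !expr0 mulr1 lern1 leq_b1.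
have rho2 : 0 <= (2 * rho) ^+ m by rewrite exprn_ge0// mulr_ge0// ltW.
rewrite mulSn Ex_cat.
apply: (@le_trans _ _ (Ex p N (fun u => (2 * rho) ^+ m *
   ((`|prj b (pt u) - x| <= 3 * D * r ^+ N)%R%:R * rho ^+ bad b N p u)))).
  apply: le_Ex => // u su.
  (* The reach 3D r^N is the radius of the ball, at most 2D r^N, plus the displacement D r^N caused
     by the remaining letters. *)
  case: (lerP `|prj b (pt u) - x| (3 * D * r ^+ N)) => [ux|ux]; last first.
    rewrite mul0r mulr0; apply: Ex_le_cst; first exact: pvec_shp.
    move=> w sw; case: (lerP `|prj b (pt (u ++ w)) - x|) => [|_]; last by rewrite mul0r.
    rewrite prj_pt_cat su => h; exfalso.
    have h1 : `|r ^+ N * prj (b - N%:R * theta) (pt w)| <= D * r ^+ N.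
      rewrite normrM gtr0_norm// mulrC ler_pM2r//.
      exact: le_trans (prj_le_nrm _ _) (nrm_pt _ _ hr _).
    have h2 : D * r ^+ (N + m * N) <= D * r ^+ N.
      rewrite ler_pM2l// exprD; apply: ler_piMr; first exact: ltW.
      by apply: exprn_ile1; exact: ltW.
    have h3 : `|prj b (pt u) - x| <= `|prj b (pt u) + r ^+ N * prj (b - N%:R * theta) (pt w) - x| +
       `|r ^+ N * prj (b - N%:R * theta) (pt w)|.
      by apply: le_trans (ler_normB _ _); rewrite le_eqVlt; apply/orP; left; apply/eqP; congr `|_|; ring.
    by move: ux; rewrite ltNge => /negP; apply; lra.
  rewrite mul1r [leRHS]mulrC.
  pose b' := b - N%:R * theta; pose x' := (x - prj b (pt u)) / r ^+ N.
  have c0 : 0 <= rho ^+ bad b N p u by rewrite exprn_ge0// ltW.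
  apply: (le_trans _ (ler_wpM2l c0 (IH b' (shp p N) x' (@pvec_shp _ _ p N hp)))).
  rewrite -ExZ; apply: le_Ex; first exact: pvec_shp.
  move=> w sw.
  rewrite [bad_count m.+1 _ _ _]/= (take_size_cat _ su) (drop_size_cat _ su) [rho ^+ (_ + _)]exprD [leLHS]mulrCA.
  rewrite ler_wpM2l ?exprn_ge0// ler_wpM2r ?exprn_ge0// ler_nat.
  case: (lerP `|prj b (pt (u ++ w)) - x|) => [h|_]; last by case: (_ <= _)%R.
  rewrite lt0b; move: h; rewrite prj_pt_cat su exprD.
  move=> h; rewrite -(ler_pM2l (rX N)) -[X in X * _ <= _](ger0_norm rNge0) -normrM.
  have -> : r ^+ N * (prj b' (pt w) - x') = prj b (pt u) + r ^+ N * prj (b - N%:R * theta) (pt w) - x.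
    rewrite /x' mulrBr mulrCA divff ?gt_eqF// mulr1 /b'; ring.
  by apply: le_trans h _; rewrite le_eqVlt; apply/orP; left; apply/eqP; ring.
rewrite ExZ exprS [leRHS]mulrC ler_wpM2l//.
apply: (@le_trans _ _ (Ex p N (fun u =>
   (`|prj b (pt u) - x| <= 3 * D * r ^+ N)%R%:R * (~~ bad b N p u)%:R + rho))).
  apply: le_Ex => // u su.
  case: (`|prj b (pt u) - x| <= _); rewrite ?mul0r ?mul1r ?add0r; last exact: ltW.
  by case: bad; rewrite /= ?expr1 ?expr0; have := rho0; lra.
by rewrite ExD Ex_cst//; have := Ex_good_reach b x hp; lra.
Qed.

(** Exponential moment over independent blocks: each contributes a factor at most 1 + B times its
    bad mass, and 1 + x <= e^x. *)
Lemma Ex_exp_bad_count m b p B : pvec p -> 1 <= B ->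
  Ex p (m * N) (fun w => B ^+ bad_count m b p w) <=
  expR (B * \sum_(0 <= j < m) bad_mass (b - j%:R * (N%:R * theta)) N (shp p (j * N))).
Proof.
move=> hp B1; have B0 : 0 <= B by lra.
elim: m b p hp => [|m IH] b p hp.
  by rewrite big_nil mulr0 expR0 mul0n /= expr0.
rewrite mulSn Ex_cat big_nat_recl//= mulrDr expRD mulr0n mul0r subr0.
apply: (@le_trans _ _ (Ex p N (fun u => expR (B *
   (\sum_(0 <= i < m) bad_mass (b - i.+1%:R * (N%:R * theta)) N (shp p (i.+1 * N)))) *
   B ^+ bad b N p u))).
  apply: le_Ex => // u su.
  have c0 : 0 <= B ^+ bad b N p u by rewrite exprn_ge0.
  rewrite [leRHS]mulrC.
  apply: (le_trans _ (ler_wpM2l c0 (le_trans (IH (b - N%:R * theta) (shp p N) (@pvec_shp _ _ p N hp)) _))).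
  - rewrite -ExZ; apply: le_Ex; first exact: pvec_shp.
    by move=> w sw; rewrite /= (take_size_cat _ su) (drop_size_cat _ su) exprD.
  - rewrite ler_expR ler_wpM2l//; apply: ler_sum => j _.
    rewrite le_eqVlt; apply/orP; left; apply/eqP.
    have -> : b - N%:R * theta - j%:R * (N%:R * theta) = b - j.+1%:R * (N%:R * theta).
      by rewrite -natr1; ring.
    have e : shp (shp p N) (j * N) = shp p (j.+1 * N).
      by apply/funext => i; rewrite shp_shp mulSn.
    by rewrite e.
rewrite ExZ [leRHS]mulrC ler_wpM2l ?expR_ge0//.
apply: le_trans (expR_ge1Dx _).
rewrite /bad_word_mass -ExZ -[X in _ <= X + _](Ex_cst N 1 hp) -ExD.
by apply: le_Ex => // u su; case: bad_word; rewrite /= ?expr1 ?expr0; lra.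
Qed.

(** Chernoff's bound with base B = e^(2M): at least m/M bad blocks make the weight at least e^(2m),
    while the hypothesis keeps its expectation below e^m. *)
Lemma Ex_many_bad m M b p : pvec p ->
  \sum_(0 <= j < m) bad_mass (b - j%:R * (N%:R * theta)) N (shp p (j * N)) <=
    m%:R * expR (- (2 * M%:R)) ->
  Ex p (m * N) (fun w => (m <= M * bad_count m b p w)%N%:R) <= expR (- m%:R).
Proof.
move=> hp hs; pose B := expR (2 * M%:R) : R.
have B1 : 1 <= B by rewrite -expR0 ler_expR mulr_ge0.
have B0 : 0 < B by lra.
have e2 : 0 < expR (2 * m%:R) :> R by exact: expR_gt0.
rewrite -(ler_pM2l e2) -ExZ -expRD.
apply: le_trans (_ : expR (m%:R) <= _); last by rewrite ler_expR; lra.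
apply: le_trans (le_trans (Ex_exp_bad_count m b hp B1) _).
  apply: le_Ex => // w sw; case: leqP => [h|_]; last by rewrite mulr0 exprn_ge0// ltW.
  rewrite mulr1 /B -expRM_natr ler_expR.
  have : m%:R <= M%:R * (bad_count m b p w)%:R :> R by rewrite -natrM ler_nat.
  by lra.
rewrite ler_expR; apply: le_trans (ler_wpM2l (ltW B0) hs) _.
by rewrite mulrCA /B -expRD subrr expR0 mulr1.
Qed.

(** With fewer than m/M bad blocks the weight in [ball_weight_le] is at least rho^(m/M), so it can
    be divided out. *)
Lemma ball_few_bad_le m M b p x : pvec p -> (0 < M)%N -> rho <= 1 ->
  Ex p (m * N) (fun w => (`|prj b (pt w) - x| <= 2 * D * r ^+ (m * N))%R%:R
                          * (M * bad_count m b p w < m)%N%:R)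
    <= (2 * rho `^ (1 - M%:R^-1)) ^+ m.
Proof.
move=> hp M0 rho1.
have M0' : 0 < M%:R :> R by rewrite ltr0n.
have c0 : 0 < rho `^ (m%:R / M%:R) by rewrite powR_gt0.
rewrite -(ler_pM2l c0) -ExZ.
have -> : rho `^ (m%:R / M%:R) * (2 * rho `^ (1 - M%:R^-1)) ^+ m = (2 * rho) ^+ m.
  rewrite [in LHS]exprMn mulrCA -[(rho `^ _) ^+ m]powR_mulrn ?powR_ge0// -powRrM -powRD; last first.
    by rewrite (gt_eqF rho0) implybT.
  have -> : m%:R / M%:R + (1 - M%:R^-1) * m%:R = m%:R :> R by ring.
  by rewrite powR_mulrn ?[RHS]exprMn//; exact: ltW.
apply: le_trans (ball_weight_le m b x hp); apply: le_Ex => // w sw.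
rewrite mulrCA ler_wpM2l//.
case: ltnP => [h|_]; last by rewrite mulr0 exprn_ge0// ltW.
rewrite mulr1 -powR_mulrn; last exact: ltW.
apply: ger_powR; first by rewrite rho0.
by rewrite ler_pdivlMr// -natrM ler_nat mulnC ltnW.
Qed.

End Bounds.
End Blocks.

(** * The coding map *)

Section Preliminaries.
Context {R : realType}.

Lemma expr_eventually_lt (r c e : R) : 0 < r < 1 -> 0 < e ->
  exists K : nat, forall k, (K <= k)%N -> c * r ^+ k < e.
Proof.
move=> /andP[r0 r1] e0.
have c0 : 0 < `|c| + 1 by rewrite ltr_wpDl.
have /cvgrPdist_lt : (fun k => r ^+ k) @ \oo --> (0 : R).
  by apply: cvg_expr; rewrite ger0_norm// ltW.
move=> /(_ (e / (`|c| + 1))); rewrite divr_gt0// => /(_ isT)[K _ hK].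
exists K => k Kk; have := hK k Kk; rewrite /= sub0r normrN ger0_norm ?exprn_ge0 ?ltW//.
rewrite ltr_pdivlMr// mulrC; apply: le_lt_trans.
by rewrite ler_wpM2r ?exprn_ge0 ?(ltW r0)// (le_trans (ler_norm _))// lerDl.
Qed.

Lemma cvg_geometric_cauchy (r c : R) (u : nat -> R) : 0 < r < 1 ->
  (forall k l, (k <= l)%N -> `|u l - u k| <= c * r ^+ k) ->
  exists x, u @ \oo --> x /\ forall k, `|x - u k| <= c * r ^+ k.
Proof.
move=> hr hu.
have /cvg_ex[x ux] : cvg (u @ \oo).
  apply: cauchy_cvg; apply: cauchy_exP => e e0.
  have [K hK] := expr_eventually_lt c hr e0.
  exists (u K); exists K => // k /= Kk; rewrite /ball/= distrC.
  by apply: le_lt_trans (hu _ _ Kk) (hK _ _).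
exists x; split => // k.
have h : (fun l => `|u l - u k|) @ \oo --> `|x - u k|.
  by apply: cvg_norm; apply: cvgB => //; exact: cvg_cst.
apply: (ler_cvg_to h (cvg_cst (c * r ^+ k))).
by exists k => // l /= kl; exact: hu.
Qed.

Lemma preimage_sigma_algebra d (T : measurableType d) U (f : T -> U) (G : set (set U)) :
  (forall A, G A -> measurable (f @^-1` A)) ->
  forall A, <<s G >> A -> measurable (f @^-1` A).
Proof.
move=> hG; apply: (@smallest_sub _ _ _ [set A | measurable (f @^-1` A)]) => //.
split => /=; first by rewrite preimage_set0.
- by move=> A mA; rewrite setTD preimage_setC; exact: measurableC.
- by move=> F mF; rewrite preimage_bigcup; exact: bigcup_measurable.
Qed.

Lemma borel2_open (A : set (R * R)) : open A -> borel2 A.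
Proof. by move=> oA; apply: sub_sigma_algebra. Qed.

Lemma borel2_bigcup (F : nat -> set (R * R)) :
  (forall k, borel2 (F k)) -> borel2 (\bigcup_k F k).
Proof. exact: sigma_algebra_bigcup. Qed.

Lemma borel2C (A : set (R * R)) : borel2 A -> borel2 (~` A).
Proof. by rewrite -setTD; exact: sigma_algebraCD. Qed.

Lemma borel2_bigcap (F : nat -> set (R * R)) :
  (forall k, borel2 (F k)) -> borel2 (\bigcap_k F k).
Proof.
move=> hF; rewrite -(setCK (\bigcap_k F k)) setC_bigcap; apply: borel2C.
by apply: borel2_bigcup => k; exact: borel2C.
Qed.

Lemma continuous_edist (x : R * R) : continuous (edist x).
Proof.
move=> y; apply/cvgrPdist_le => e e0.
exists (ball y.1 (e / 2), ball y.2 (e / 2)); first by split; apply: nbhsx_ballx; rewrite divr_gt0.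
move=> z /= [h1 h2].
have h : edist y z <= e.
  apply: le_trans (edist2_le_sum _ _) _.
  by move: h1 h2; rewrite /ball/= => /ltW h1 /ltW h2; rewrite [e]splitr lerD.
apply: le_trans h; rewrite ler_norml; apply/andP; split.
  by have := edist2_triangle y x z; lra.
by have := edist2_triangle z x y; rewrite (edist2C z y); lra.
Qed.

Lemma closed_edist_ball (x : R * R) (c : R) : closed [set y | edist x y <= c].
Proof.
have -> : [set y | edist x y <= c] = edist x @^-1` [set t | t <= c] by [].
by apply: closed_comp => [y _|]; [exact: continuous_edist|exact: closed_le].
Qed.

Lemma borel2_closed (A : set (R * R)) : closed A -> borel2 A.
Proof. by rewrite -openC => oA; rewrite -(setCK A); apply: borel2C; exact: borel2_open. Qed.

Lemma borel2_edist_ball (x : R * R) (c : R) : borel2 [set y | edist x y <= c].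
Proof. by apply: borel2_closed; exact: closed_edist_ball. Qed.

Lemma borel2_preimage (f : R * R -> R * R) (A : set (R * R)) :
  continuous f -> borel2 A -> borel2 (f @^-1` A).
Proof.
move=> cf; apply: (@preimage_sigma_algebra _ (g_sigma_algebraType (@open (R * R)%type)) _ f).
by move=> B oB; apply: borel2_open; exact: open_comp.
Qed.

Lemma continuous_proj_line (b : R) : continuous (@proj_line R b).
Proof.
move=> x; rewrite /proj_line.
have h : (fun y : R * R => y.1 * cos b + y.2 * sin b) @ x --> x.1 * cos b + x.2 * sin b.
  by apply: cvgD; apply: cvgMr_tmp; [exact: cvg_fst|exact: cvg_snd].
have h1 : (fun y : R * R => (y.1 * cos b + y.2 * sin b) * cos b) @ x -->
  (x.1 * cos b + x.2 * sin b) * cos b by apply: cvgMr_tmp.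
have h2 : (fun y : R * R => (y.1 * cos b + y.2 * sin b) * sin b) @ x -->
  (x.1 * cos b + x.2 * sin b) * sin b by apply: cvgMr_tmp.
exact: (cvg_pair h1 h2).
Qed.

End Preliminaries.

Section Coding.
Context {R : realType} {n : nat} (r theta : R) (a : Lam n -> R * R).
Hypothesis hr : 0 < r < 1.
Implicit Types (w u : seq (Lam n)) (s : Sigma n).

Let r0 : 0 < r. Proof. by case/andP: hr. Qed.
Let r1 : r < 1. Proof. by case/andP: hr. Qed.
Local Notation D := (ptbound r a).
Local Notation pt := (pt r theta a).
Local Notation coding := (@coding R n r theta a).
Let D0 : 0 < D. Proof. exact: lt_le_trans (ptbound_ge1 a hr). Qed.

Lemma mkseq_take (s : nat -> Lam n) k l : (k <= l)%N -> take k (mkseq s l) = mkseq s k.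
Proof.
by move=> kl; rewrite /mkseq -map_take take_iota (minn_idPl kl).
Qed.

Lemma edist_pt_mkseq (s : nat -> Lam n) k l : (k <= l)%N ->
  edist (pt (mkseq s k)) (pt (mkseq s l)) <= D * r ^+ k.
Proof.
move=> kl; rewrite -(mkseq_take s kl); apply: edist_pt_take => //.
by rewrite size_mkseq.
Qed.

Lemma coding_cvg s : (fun k => ifs_comp r theta a s k (0, 0)) @ \oo --> coding s.
Proof.
(* [xget] returns the default (0, 0) when no limit exists, so a limit is exhibited
   coordinatewise. *)
apply: (@xgetPex _ _ [set x : R * R | (fun k => ifs_comp r theta a s k (0, 0)) @ \oo --> x]).
have e k : ifs_comp r theta a s k (0, 0) = ((pt (mkseq s k)).1, (pt (mkseq s k)).2).
  by rewrite ifs_comp_mkseq -surjective_pairing.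
have [|x1 [h1 _]] := @cvg_geometric_cauchy R r D (fun k => (pt (mkseq s k)).1) hr.
  move=> k l kl; rewrite distrC; apply: le_trans (edist2_ge1 _ _) _; exact: edist_pt_mkseq.
have [|x2 [h2 _]] := @cvg_geometric_cauchy R r D (fun k => (pt (mkseq s k)).2) hr.
  move=> k l kl; rewrite distrC; apply: le_trans (edist2_ge2 _ _) _; exact: edist_pt_mkseq.
exists (x1, x2) => /=.
by under eq_fun do rewrite e; exact: (cvg_pair h1 h2).
Qed.

Lemma edist_coding s k : edist (pt (mkseq s k)) (coding s) <= D * r ^+ k.
Proof.
have h : (fun l => edist (pt (mkseq s k)) (ifs_comp r theta a s l (0, 0))) @ \oo -->
    edist (pt (mkseq s k)) (coding s).
  by apply: (cvg_comp _ _ (@coding_cvg s)); exact: continuous_edist.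
apply: (ler_cvg_to h (cvg_cst (D * r ^+ k))).
by exists k => // l /= kl; rewrite ifs_comp_mkseq; exact: edist_pt_mkseq.
Qed.

Lemma prj_coding b s k : `|prj b (pt (mkseq s k)) - prj b (coding s)| <= D * r ^+ k.
Proof. exact: le_trans (prj_lipschitz _ _ _) (edist_coding _ _). Qed.

Definition prefix_set k (P : pred (seq (Lam n))) : set (Sigma n) := [set s | P (mkseq s k)].

Lemma cylE (s0 : nat -> Lam n) k : @cyl n s0 k = [set s | mkseq s k = mkseq s0 k].
Proof.
apply/seteqP; split => s /=.
  by move=> h; apply/eq_in_map => j; rewrite mem_iota add0n; exact: h.
move=> h j jk; have := congr1 (fun w => nth (s 0%N) w j) h.
by rewrite !nth_mkseq.
Qed.

Let ext (v : seq (Lam n)) : nat -> Lam n := nth ord0 v.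
Lemma mkseq_ext v : mkseq (ext v) (size v) = v. Proof. exact: mkseq_nth. Qed.

(** A cylinder cut by a condition on l further letters. Splitting it by its next letter gives both
    its measurability and its measure by induction on l. *)
Let ext_set v l (P : pred (seq (Lam n))) : set (Sigma n) :=
  [set s | mkseq s (size v) = v /\ P (mkseq s (size v + l))].

Let ext_setS v l P :
  ext_set v l.+1 P = \big[setU/set0]_(i < n.+1) ext_set (rcons v (i : Lam n)) l P.
Proof.
rewrite -bigcup_mkord_ord; apply/seteqP; split => s /=.
  move=> [h hP]; exists (nat_of_ord (s (size v))); first exact: ltn_ord.
  rewrite /ext_set /= inord_val size_rcons mkseqS h.
  by rewrite addSn -addnS.
move=> [i _]; rewrite /ext_set /= size_rcons mkseqS addSn -addnS => -[h hP]; split => //.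
by case/rcons_inj: h.
Qed.

Let ext_set_mes v l P : measurable (ext_set v l P).
Proof.
elim: l v => [|l IH] v; last by rewrite ext_setS; apply: bigsetU_measurable => i _.
have [Pv|nPv] := boolP (P v).
  have -> : ext_set v 0 P = @cyl n (ext v) (size v).
    rewrite cylE mkseq_ext; apply/seteqP; split => s /=; rewrite /ext_set /= addn0.
      by case.
    by move=> ->; split.
  by apply: sub_sigma_algebra; exists (ext v), (size v).
rewrite (_ : ext_set v 0 P = set0)//; apply/seteqP; split => s //=.
by rewrite /ext_set/= addn0 => -[->]; rewrite (negbTE nPv).
Qed.

Lemma measurable_prefix_set k P : measurable (prefix_set k P).
Proof.
have := ext_set_mes [::] k P; congr measurable.
by apply/seteqP; split => s /=; rewrite /ext_set /prefix_set /= ?add0n; [case|split].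
Qed.

Variables (nu : {measure set (Sigma n) -> \bar R}) (p : nat -> Lam n -> R).
Hypothesis nu_cyl : forall (w : nat -> Lam n) k, nu (cyl w k) = (\prod_(j < k) p j (w j))%:E.

Lemma mass_mkseq (q : nat -> Lam n -> R) (s : nat -> Lam n) k :
  mass q (mkseq s k) = \prod_(j < k) q j (s j).
Proof.
elim: k q s => [|k IH] q s; first by rewrite big_ord0.
have e : iota 1 k = map (addn 1) (iota 0 k) by rewrite -iotaDl addn0.
rewrite big_ord_recl -(IH (fun j => q j.+1) (fun j => s j.+1)).
by rewrite /mkseq /= e -map_comp.
Qed.

Let nu_ext_set v l P :
  nu (ext_set v l P) = (mass p v * Ex (shp p (size v)) l (fun u => (P (v ++ u))%:R))%:E.
Proof.
elim: l v => [|l IH] v.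
  rewrite /= cats0; have [Pv|nPv] := boolP (P v).
    have -> : ext_set v 0 P = @cyl n (ext v) (size v).
      rewrite cylE mkseq_ext; apply/seteqP; split => s /=; rewrite /ext_set /= addn0.
        by case.
      by move=> ->; split.
    by rewrite nu_cyl -mass_mkseq mkseq_ext mulr1.
  rewrite (_ : ext_set v 0 P = set0) ?measure0 ?mulr0//; apply/seteqP; split => s //=.
  by rewrite /ext_set/= addn0 => -[->]; rewrite (negbTE nPv).
rewrite ext_setS measure_semi_additive_ord//; last 2 first.
- apply/trivIsetP => i j _ _ ij; apply/seteqP; split => s //=.
  rewrite /ext_set /= !size_rcons !mkseqS => -[[h1 _] [h2 _]].
  have [_ e1] := rcons_inj h1; have [_ e2] := rcons_inj h2.
  by move: ij; rewrite -e1 -e2 eqxx.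
- by apply: bigsetU_measurable => i _; exact: ext_set_mes.
rewrite (eq_bigr (fun i : 'I_n.+1 => (mass p v * (shp p (size v) 0 i *
    Ex (shp p (size v).+1) l (fun u => (P (v ++ i :: u))%:R)))%:E)); last first.
  move=> i _; rewrite [LHS](IH (rcons v (i : Lam n))) size_rcons mulrA; congr (_ * _)%:E.
    have mass_rcons q : mass q (rcons v i) = mass q v * q (size v) i.
      by elim: v q {IH} => [|j v IHv] q /=; rewrite ?mulr1 ?mul1r// IHv mulrA.
    by rewrite mass_rcons /shp addn0.
  by apply: eq_Ex => u _; rewrite cat_rcons.
rewrite sumEFin /= -mulr_sumr; congr (_ * _)%:E; apply: eq_bigr => i _; congr (_ * _).
by apply: eq_Exp => j i' _; rewrite /shp addnS.
Qed.

(** The bridge from expectations over finite words to the measure [nu]. *)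
Lemma nu_prefix_set k P : nu (prefix_set k P) = (Ex p k (fun w => (P w)%:R))%:E.
Proof.
have -> : prefix_set k P = ext_set [::] k P.
  by apply/seteqP; split => s /=; rewrite /ext_set /prefix_set /= ?add0n; [split|case].
by rewrite nu_ext_set /= mul1r.
Qed.

(** If a coded point lies in an open set, some prefix already forces this, so the preimage of an
    open set is a countable union of prefix events. *)
Lemma coding_borel (A : set (R * R)) : borel2 A -> measurable (coding @^-1` A).
Proof.
apply: preimage_sigma_algebra => {}A oA.
pose P k (w : seq (Lam n)) := `[< forall x, edist (pt w) x <= D * r ^+ k -> A x >].
have -> : coding @^-1` A = \bigcup_k prefix_set k (P k).
  apply/seteqP; split => s /=; last first.
    by move=> [k _ /asboolP]; apply; exact: edist_coding.
  move=> As; have /nbhs_ballP[e /= e0 eA] := open_nbhs_nbhs (conj oA As).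
  (* The disc of radius D r^K about the prefix point stays within 2D r^K of the coded point. *)
  have [K hK] := expr_eventually_lt (2 * D) hr e0.
  exists K => //; apply/asboolP => x hx; apply: eA.
  have := edist2_triangle (pt (mkseq s K)) (coding s) x.
  have := edist_coding s K; rewrite edist2C; have := hK K (leqnn K) => h1 h2 h3.
  have {h1 h2 h3}h : edist (coding s) x < e by lra.
  by split; [apply: le_lt_trans (edist2_ge1 _ _) h|apply: le_lt_trans (edist2_ge2 _ _) h].
by apply: bigcup_measurable => k _; exact: measurable_prefix_set.
Qed.

End Coding.

(** * Hausdorff measures *)

Section Hausdorff.
Context {R : realType}.
Implicit Types (s e c : R) (A U : set (R * R)) (x y : R * R).

Definition cball x c : set (R * R) := [set y | edist x y <= c].

Lemma cover_term_ge0 s U : (0 <= cover_term s U)%E.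
Proof. by rewrite /cover_term; case: pselect => /= ?; rewrite lee_fin ?powR_ge0. Qed.

Lemma diamE_cball x c U : U `<=` cball x c -> (diamE U <= (2 * c)%:E)%E.
Proof.
move=> Uc; apply: ge_ereal_sup => _ [y Uy [z Uz <-]]; rewrite lee_fin.
have := edist2_triangle x y z; rewrite (edist2C y x).
by move: (Uc _ Uy) (Uc _ Uz); rewrite /cball/=; lra.
Qed.

Lemma diamE_fin U e : U !=set0 -> (diamE U <= e%:E)%E ->
  exists d : R, [/\ diamE U = d%:E, 0 <= d, d <= e & forall x y, U x -> U y -> edist x y <= d].
Proof.
move=> [x Ux] h.
have h0 x' y' : U x' -> U y' -> ((edist x' y')%:E <= diamE U)%E.
  by move=> Ux' Uy'; apply: ereal_sup_ubound; exists x' => //; exists y'.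
have d0 : (0 <= diamE U)%E by apply: le_trans (h0 x x Ux Ux); rewrite lee_fin edist2_ge0.
have df : diamE U \is a fin_num.
  by rewrite fin_numElt (lt_le_trans _ d0)//= ?(le_lt_trans h) ?ltry// ltNye.
exists (fine (diamE U)); rewrite -(fineK df) in h0 h d0 *; split => //=.
Qed.

Lemma cover_termE s U d : U !=set0 -> diamE U = d%:E -> cover_term s U = (d `^ s)%:E.
Proof.
move=> U0 dU; rewrite /cover_term; case: pselect => /= [U0'|?]; last by rewrite dU.
by move: U0; rewrite U0' => -[].
Qed.

Lemma cover_term_cball s x c U : 0 <= s -> 0 <= c -> U `<=` cball x c ->
  (cover_term s U <= ((2 * c) `^ s)%:E)%E.
Proof.
move=> s0 c0 Uc; have [->|/set0P U0] := eqVneq U set0.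
  by rewrite /cover_term; case: pselect => /= ?; rewrite lee_fin ?powR_ge0.
have [d [dE d0 dc _]] := diamE_fin U0 (diamE_cball Uc).
by rewrite (cover_termE _ U0 dE) lee_fin; apply: ge0_ler_powR => //; rewrite nnegrE// mulr_ge0.
Qed.

Lemma hmeasure0_cover s A (delta e : R) : hmeasure s A = 0%E -> 0 < delta -> 0 < e ->
  exists F : nat -> set (R * R), [/\ A `<=` \bigcup_k F k,
    forall k, (diamE (F k) <= delta%:E)%E &
    (\sum_(0 <= k <oo) cover_term s (F k) < e%:E)%E].
Proof.
move=> h d0 e0.
have : (hcontent s delta A < e%:E)%E.
  apply: (@le_lt_trans _ _ 0%E); last by rewrite lte_fin.
  by rewrite -h; apply: ereal_sup_ubound; exists delta.
by move=> /ereal_inf_lt[_ [F [FA Fd] <-] Fe]; exists F.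
Qed.

Lemma hcontent_ge0 s delta A : (0 <= hcontent s delta A)%E.
Proof.
by apply: le_ereal_inf_tmp => _ [F _ <-]; apply: nneseries_ge0 => k _ _; exact: cover_term_ge0.
Qed.

Lemma hmeasure0_of_double_covers s A :
  (forall delta e, 0 < delta -> 0 < e -> exists G : nat -> nat -> set (R * R),
    [/\ A `<=` \bigcup_i \bigcup_j G i j, forall i j, (diamE (G i j) <= delta%:E)%E &
       (\sum_(0 <= i <oo) \sum_(0 <= j <oo) cover_term s (G i j) <= e%:E)%E]) ->
  hmeasure s A = 0%E.
Proof.
move=> h; apply/eqP; rewrite eq_le; apply/andP; split; last first.
  apply: le_trans (hcontent_ge0 s 1 A) _.
  by apply: ereal_sup_ubound; exists 1 => //=.
apply: ge_ereal_sup => _ [delta /= d0 <-].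
apply/lee_addgt0Pr => e e0; rewrite add0e.
have [G [GA Gd Ge]] := h _ _ d0 e0; apply: le_trans Ge.
have /card_esym/ppcard_eqP[f] := card_nat2.
apply: ereal_inf_lbound; exists (fun k => G (f k).1 (f k).2).
  split => // x Ax; have [i _ [j _ Gx]] := GA _ Ax.
  by exists (f^-1%FUN (i, j)) => //=; rewrite invK ?inE.
rewrite nneseries_esumT; last by move=> k; exact: cover_term_ge0.
rewrite -(reindex_esum setT setT f (fun ij => cover_term s (G ij.1 ij.2))); first last; [by have := @bijTT _ _ f; rewrite -setTT_bijective|].
rewrite (_ : setT = setT `*`` (fun=> setT)); last by apply/seteqP; split.
rewrite -(@esum_esum _ _ _ _ _ (fun i j => cover_term s (G i j))); last first.
  by move=> *; exact: cover_term_ge0.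
rewrite nneseries_esumT; last by move=> i; apply: nneseries_ge0 => j _ _; exact: cover_term_ge0.
by apply: eq_esum => i _; rewrite nneseries_esumT// => j; exact: cover_term_ge0.
Qed.

Lemma nneseries_finite (f : nat -> \bar R) N : (forall k, (0 <= f k)%E) ->
  (forall k, (N <= k)%N -> f k = 0%E) ->
  (\sum_(0 <= k <oo) f k = \sum_(0 <= k < N) f k)%E.
Proof.
move=> f0 fN; rewrite (nneseries_split 0 N)//.
by rewrite add0n [X in (_ + X)%E]eseries0 ?adde0// => k Nk _; exact: fN.
Qed.

Lemma hmeasure0_of_balls s A : 0 <= s ->
  (forall delta e, 0 < delta -> 0 < e -> exists (L : nat -> seq (R * R)) (rad : nat -> R),
    [/\ forall i, 0 <= rad i <= delta, forall x, A x -> exists i y, y \in L i /\ cball y (rad i) x &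
       (\sum_(0 <= i <oo) ((size (L i))%:R * (2 * rad i) `^ s)%:E <= e%:E)%E]) ->
  hmeasure s A = 0%E.
Proof.
move=> s0 h; apply: hmeasure0_of_double_covers => delta e d0 e0.
have [||L [rad [hrad LA Le]]] := h (delta / 2) e; [by rewrite divr_gt0|by []|].
pose G i j := if (j < size (L i))%N then cball (nth (0, 0) (L i) j) (rad i) else set0.
have Gsub i j : G i j `<=` cball (nth (0, 0) (L i) j) (rad i).
  by move=> y; rewrite /G; case: ifP.
exists G; split.
- move=> x Ax; have [i [y [yL yx]]] := LA _ Ax.
  exists i => //; exists (index y (L i)) => //.
  by rewrite /G index_mem yL nth_index.
- move=> i j; apply: le_trans (diamE_cball (@Gsub i j)) _.
  by rewrite lee_fin; have := hrad i; lra.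
apply: le_trans Le; apply: lee_nneseries => [i _ _|i _].
  by apply: nneseries_ge0 => j _ _; exact: cover_term_ge0.
rewrite (@nneseries_finite _ (size (L i))).
- apply: (@le_trans _ _ (\sum_(0 <= j < size (L i)) ((2 * rad i) `^ s)%:E)%E).
    apply: lee_sum => j _; apply: cover_term_cball (@Gsub i j) => //.
    by have /andP[] := hrad i.
  by rewrite sumEFin lee_fin sumr_const_nat subn0 -[leLHS]mulr_natl.
- by move=> j; exact: cover_term_ge0.
- move=> j Lj; rewrite /G ltnNge Lj /= /cover_term.
  by case: pselect => // h'; case: h'.
Qed.

Lemma hmeasure0_of_balls_pow2 s A : 0 <= s ->
  (forall delta e, 0 < delta -> 0 < e -> exists (L : nat -> seq (R * R)) (rad : nat -> R),
    [/\ forall i, 0 <= rad i <= delta, forall x, A x -> exists i y, y \in L i /\ cball y (rad i) x &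
       forall i, (size (L i))%:R * (2 * rad i) `^ s <= e / (2 ^ i.+1)%:R]) ->
  hmeasure s A = 0%E.
Proof.
move=> s0 h; apply: hmeasure0_of_balls => // delta e d0 e0.
have [L [rad [hrad LA Le]]] := h delta e d0 e0.
exists L, rad; split => //.
apply: le_trans (epsilon_trick0 xpredT (ltW e0)).
apply: lee_nneseries => [i _ _|i _]; last by rewrite lee_fin.
by rewrite lee_fin mulr_ge0// powR_ge0.
Qed.


(* The distance-decreasing image is enlarged to a Borel set, since it need not
   be Borel itself: each set of a cover is replaced by a closed disc. *)
Lemma hmeasure0_lipschitz s A (f : R * R -> R * R) :
  (forall x y, edist (f x) (f y) <= edist x y) -> 0 <= s -> hmeasure s A = 0%E ->
  exists B, [/\ borel2 B, f @` A `<=` B & hmeasure s B = 0%E].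
Proof.
move=> lipf s0 hA.
have c0 : 0 < 2 `^ s :> R by rewrite powR_gt0.
have /choice[Fn hFn] (m : nat) : exists F : nat -> set (R * R), [/\ A `<=` \bigcup_k F k,
    forall k, (diamE (F k) <= (m.+1%:R^-1)%:E)%E &
    (\sum_(0 <= k <oo) cover_term s (F k) < (m.+1%:R^-1)%:E)%E].
  by apply: hmeasure0_cover; rewrite // invr_gt0.
pose z m k : seq (R * R) := if pselect (Fn m k !=set0) is left h then [:: f (projT1 (cid h))] else [::].
pose rad m k : R := if pselect (Fn m k !=set0) then fine (diamE (Fn m k)) else 0.
pose B := \bigcap_m \bigcup_k \bigcup_j
  (if (j < size (z m k))%N then cball (nth (0, 0) (z m k) j) (rad m k) else set0).
exists B; split.
- apply: borel2_bigcap => m; apply: borel2_bigcup => k; apply: borel2_bigcup => j.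
  case: ifP => _; first exact: borel2_edist_ball.
  by apply: borel2_open; exact: open0.
- move=> _ [x Ax <-] m _.
  have [FA Fd _] := hFn m; have [k _ Fx] := FA _ Ax.
  exists k => //; exists 0%N => //; rewrite /z /rad.
  case: pselect => h; last by exfalso; apply: h; exists x.
  rewrite /=; case: cid => y Fy /=; rewrite /cball/=.
  have [d [dE _ _ hd]] := diamE_fin h (Fd k).
  by rewrite dE /=; apply: le_trans (lipf _ _) _; exact: hd.
apply: hmeasure0_of_balls => // delta e d0 e0.
(* A set of diameter d is replaced by a disc of radius d, for which the diameter bound is 2d; the
   resulting factor 2^s is absorbed here. *)
pose e' := Num.min delta (e / 2 `^ s).
have e'0 : 0 < e' by rewrite lt_min d0 divr_gt0.
have [m hm] : exists m : nat, m.+1%:R^-1 < e'.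
  exists (Num.truncn e'^-1); rewrite invf_plt ?posrE//; exact: truncnS_gt.
have [FA Fd Fe] := hFn m.
exists (z m), (rad m); split.
- move=> k; rewrite /rad; case: pselect => h /=; last by rewrite lexx ltW.
  have [d [dE d0' dm _]] := diamE_fin h (Fd k).
  rewrite dE /= d0' (le_trans dm)// (le_trans (ltW hm))// ge_min lexx//.
- move=> x /(_ m I)[k _ [j _]]; case: ifPn => // jz h.
  by exists k, (nth (0, 0) (z m k) j); split => //; exact: mem_nth.
apply: (@le_trans _ _ (\sum_(0 <= k <oo) ((2 `^ s)%:E * cover_term s (Fn m k)))%E).
  apply: lee_nneseries => [k _ _|k _]; first by rewrite lee_fin mulr_ge0// powR_ge0.
  rewrite /z /rad; case: pselect => h /=; last first.
    by rewrite mul0r mule_ge0// ?lee_fin ?powR_ge0// cover_term_ge0.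
  have [d [dE d0' _ _]] := diamE_fin h (Fd k).
  by rewrite (cover_termE _ h dE) dE /= mul1r powRM// EFinM.
rewrite nneseriesZl; last by move=> k _; exact: cover_term_ge0.
apply: (@le_trans _ _ ((2 `^ s)%:E * (m.+1%:R^-1)%:E)%E).
  by apply: lee_wpmul2l; [rewrite lee_fin powR_ge0|exact: ltW].
rewrite -EFinM lee_fin mulrC -ler_pdivlMr//.
by apply: le_trans (ltW hm) _; rewrite ge_min lexx orbT.
Qed.

Lemma dimH_le s A : 0 <= s -> hmeasure s A = 0%E -> (dimH A <= s%:E)%E.
Proof. by move=> s0 h; apply: ereal_inf_lbound; exists s. Qed.

Lemma dimH_meas_le s A (lam : set (R * R) -> \bar R) :
  borel2 A -> (0 < lam A)%E -> 0 <= s -> hmeasure s A = 0%E -> (dimH_meas lam <= s%:E)%E.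
Proof.
move=> bA lA s0 h; apply: le_trans (dimH_le s0 h).
by apply: ereal_inf_lbound; exists A.
Qed.

Lemma dimH_meas_lt (t : \bar R) (lam : set (R * R) -> \bar R) : (dimH_meas lam < t)%E ->
  exists s A, [/\ 0 <= s, (s%:E < t)%E, borel2 A, (0 < lam A)%E & hmeasure s A = 0%E].
Proof.
move=> /ereal_inf_lt[_ [A [bA lA] <-]] /ereal_inf_lt[_ [s [s0 h] <-] st].
by exists s, A.
Qed.

Lemma dimH_meas_ge0 (lam : set (R * R) -> \bar R) : (0 <= dimH_meas lam)%E.
Proof.
apply: le_ereal_inf_tmp => _ [A _ <-]; apply: le_ereal_inf_tmp => _ [s [s0 _] <-].
by rewrite lee_fin.
Qed.

End Hausdorff.

(** * Dimension of projections *)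

Section Scales.
Context {R : realType}.

Lemma powR_lt1 (q s : R) : 0 < q < 1 -> 0 < s -> 0 < q `^ s < 1.
Proof.
move=> /andP[q0 q1] s0; rewrite powR_gt0//=.
have := @gt0_ltr_powR R s s0 q 1; rewrite powR1; apply; rewrite ?nnegrE//; exact: ltW.
Qed.

(** For d > 0 take the last power of q, from q^m1 on, that is still at least d; then d > q^(m+1),
    which gives the constant q^(-s). For d = 0 there is no last one, and e pays for a sufficiently
    late power. *)
Lemma scale_choice (q s s' d e : R) m1 : 0 < q < 1 -> 0 <= s < s' -> 0 <= d <= q ^+ m1 ->
  0 < e -> exists m, [/\ (m1 <= m)%N, d <= q ^+ m & (q `^ s') ^+ m <= q `^ (- s) * d `^ s + e].
Proof.
move=> hq /andP[s0 ss'] /andP[d0 dm1] e0; have /andP[q0 q1] := hq.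
have s'0 : 0 < s' by apply: le_lt_trans ss'.
have [dE|dn0] := eqVneq d 0.
  have [K hK] := expr_eventually_lt 1 (powR_lt1 hq s'0) e0.
  exists (maxn m1 K); split; [exact: leq_maxl|by rewrite dE exprn_ge0// ltW|].
  have := hK _ (leq_maxr m1 K); rewrite mul1r => /ltW/le_trans; apply.
  by rewrite lerDr mulr_ge0// powR_ge0.
have {dn0 d0}d0 : 0 < d by rewrite lt_def dn0.
have ex : exists j, q ^+ (m1 + j.+1) < d.
  have [K hK] := expr_eventually_lt 1 hq d0.
  by exists K; have := hK (m1 + K.+1)%N; rewrite mul1r; apply; lia.
have [j hj jmin] := ex_minnP ex.
exists (m1 + j)%N; split; first exact: leq_addr.
  case: j hj jmin => [|j] hj jmin; first by rewrite addn0.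
  by rewrite leNgt; apply/negP => /jmin; rewrite ltnn.
apply: (@le_trans _ _ (q `^ (- s) * d `^ s)); last by rewrite lerDl ltW.
apply: (@le_trans _ _ ((q `^ s) ^+ (m1 + j))).
  rewrite lerXn2r ?nnegrE ?powR_ge0//; apply: ger_powR; first by rewrite q0 ltW.
  exact: ltW.
rewrite -powR_mulrn ?powR_ge0// -powRrM mulrC powRrM powR_mulrn; last exact: ltW.
have -> : q `^ (- s) = (q^-1) `^ s.
  by rewrite -powR_inv1 -?powRrM ?mulN1r//; exact: ltW.
have qV : 0 <= q^-1 by rewrite invr_ge0 ltW.
have d0' := ltW d0.
rewrite -powRM//.
apply: ge0_ler_powR => //; rewrite ?nnegrE.
- by rewrite exprn_ge0// ltW.
- exact: mulr_ge0.
by rewrite mulrC ler_pdivlMr// -exprSr -addnS ltW.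
Qed.

Lemma expRN_le_pow2 m : expR (- m%:R) <= (2 ^ m)%:R^-1 :> R.
Proof.
rewrite expRN lef_pV2 ?posrE ?expR_gt0 ?ltr0n ?expn_gt0//.
rewrite natrX -[m%:R]mul1r expRM_natr lerXn2r ?nnegrE ?expR_ge0//.
by have := expR_ge1Dx (1 : R); lra.
Qed.

End Scales.

Section ProjectedDimension.
Context {R : realType} {n : nat} (r theta : R) (a : Lam n -> R * R).
Hypothesis hr : 0 < r < 1.
Variables (nu : {measure set (Sigma n) -> \bar R}) (p : nat -> Lam n -> R).
Hypothesis nu_cyl : forall (w : nat -> Lam n) k, nu (cyl w k) = (\prod_(j < k) p j (w j))%:E.
Hypothesis hp : pvec p.

Let r0 : 0 < r. Proof. by case/andP: hr. Qed.
Let r1 : r < 1. Proof. by case/andP: hr. Qed.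
Local Notation D := (ptbound r a).
Local Notation pt := (pt r theta a).
Local Notation coding := (@coding R n r theta a).
Let D1 : 1 <= D. Proof. exact: ptbound_ge1. Qed.
Let D0 : 0 < D. Proof. exact: lt_le_trans ltr01 D1. Qed.
Local Notation image_dim := (dimH_meas (fun A => nu (coding @^-1` A))).
Local Notation proj_dim b :=
  (dimH_meas (fun A => nu (coding @^-1` (proj_line b @^-1` A)))).

Lemma nu_setT : nu setT = 1%E.
Proof.
have -> : setT = prefix_set 0 xpredT :> set (Sigma n) by apply/seteqP.
by rewrite (nu_prefix_set nu_cyl).
Qed.

Lemma nu_fin A : measurable A -> nu A \is a fin_num.
Proof.
move=> mA; rewrite fin_numElt (lt_le_trans _ (measure_ge0 _ _))//=.
apply: (@le_lt_trans _ _ 1%E); last by rewrite ltry.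
by rewrite -nu_setT; apply: le_measure; rewrite ?inE.
Qed.

Lemma proj_coding_borel b A : borel2 A ->
  measurable (coding @^-1` (proj_line b @^-1` A)).
Proof.
by move=> bA; apply: (coding_borel _ _ hr); apply: borel2_preimage => //; exact: continuous_proj_line.
Qed.

(** Mass distribution with exceptional words: at level m the ball bound holds on the words
    satisfying [P m], and the others have summable mass. A set of positive measure v0 and zero
    s-dimensional measure would then have mass at most 3 v0 / 4. *)
Lemma proj_dim_ge b s' N (P : nat -> pred (seq (Lam n))) m0 : (0 < N)%N -> 0 < s' ->
  (forall m, (m0 <= m)%N -> Ex p (m * N) (fun w => (~~ P m w)%:R) <= expR (- m%:R)) ->
  (forall m x, (m0 <= m)%N ->
    Ex p (m * N) (fun w => (`|prj b (pt w) - x| <= 2 * D * r ^+ (m * N))%R%:R * (P m w)%:R)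
      <= ((r ^+ N) `^ s') ^+ m) ->
  (s'%:E <= proj_dim b)%E.
Proof.
move=> N0 s'0 hbad hball; rewrite leNgt; apply/negP => /dimH_meas_lt[s [A [s0 ss' bA nA hA]]].
rewrite lte_fin in ss'.
pose q := r ^+ N.
have hq : 0 < q < 1 by rewrite /q exprn_gt0//= exprn_ilt1// ?ltW// -lt0n.
have /andP[q0 q1] := hq.
set S := coding @^-1` _ in nA.
have mS : measurable S by exact: proj_coding_borel.
pose v0 := fine (nu S).
have v0E : nu S = v0%:E by rewrite fineK// nu_fin.
have v0p : 0 < v0 by rewrite -lte_fin -v0E.
(* One quarter each for the exceptional words, the sum over the cover, and the errors left by
   [scale_choice]. *)
pose e1 := v0 / 4.
have e10 : 0 < e1 by rewrite divr_gt0.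
have half : 0 < (2^-1 : R) < 1 by lra.
have [K1 hK1] := expr_eventually_lt 2 half e10.
pose m1 := maxn m0 K1.
pose Bad m := prefix_set ((m1 + m) * N) (fun w => ~~ P (m1 + m)%N w).
have nuBad m : (nu (Bad m) <= (e1 / (2 ^ m.+1)%:R)%:E)%E.
  rewrite (nu_prefix_set nu_cyl) lee_fin.
  apply: le_trans (hbad _ _) _.
    exact: leq_trans (leq_maxl m0 K1) (leq_addr _ _).
  apply: le_trans (expRN_le_pow2 _) _.
  have h : 2 * 2^-1 ^+ m1 <= e1 by apply/ltW/hK1; rewrite leq_maxr.
  rewrite !natrX exprD exprS ler_pdivlMr ?mulr_gt0 ?exprn_gt0//.
  apply: le_trans h; rewrite exprVn.
  have p1 : (2 ^+ m1 : R) != 0 by rewrite expf_neq0.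
  have p2 : (2 ^+ m : R) != 0 by rewrite expf_neq0.
  move: (2 ^+ m1 : R) (2 ^+ m : R) p1 p2 => x y x0 y0.
  by rewrite le_eqVlt; apply/orP; left; apply/eqP; field; rewrite x0.
pose c := q `^ (- s).
have c0 : 0 < c by rewrite powR_gt0.
have delta0 : 0 < q ^+ m1 by rewrite exprn_gt0.
have [F [FA Fd Fe]] := hmeasure0_cover hA delta0 (divr_gt0 e10 c0).
(* The sets of a cover are arbitrary and their preimages may fail to be measurable; each preimage is
   replaced by a prefix event containing its non-exceptional part. *)
have /choice[C hC] (k : nat) : exists C : set (Sigma n), [/\ measurable C,
   forall t, coding t \in proj_line b @^-1` F k -> (forall m, ~ Bad m t) -> C t &
   (nu C <= c%:E * cover_term s (F k) + (e1 / (2 ^ k.+1)%:R)%:E)%E].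
  have pos : (0 <= c%:E * cover_term s (F k) + (e1 / (2 ^ k.+1)%:R)%:E)%E.
    apply: adde_ge0; last by rewrite lee_fin divr_ge0// ltW.
    by apply: mule_ge0; [rewrite lee_fin ltW|exact: cover_term_ge0].
  have [[t0 ht0]|hn] := pselect (exists t, F k (proj_line b (coding t))); last first.
    exists set0; split => //; last by rewrite measure0.
    by move=> t /set_mem ht; exfalso; apply: hn; exists t.
  have F0 : F k !=set0 by exists (proj_line b (coding t0)).
  have [d [dE d0 dm hd]] := diamE_fin F0 (Fd k).
  have [|||m [m1m dqm hm]] := @scale_choice R q s s' d (e1 / (2 ^ k.+1)%:R) m1 hq.
  - by rewrite s0.
  - by rewrite d0.
  - by rewrite divr_gt0// ltr0n expn_gt0.
  pose x := prj b (coding t0).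
  exists (prefix_set (m * N) (fun w => (`|prj b (pt w) - x| <= 2 * D * r ^+ (m * N))%R && P m w)).
  split; first exact: measurable_prefix_set.
  - move=> t /set_mem ht nBad; rewrite /prefix_set /=; apply/andP; split; last first.
      apply: contra_notT (nBad (m - m1)%N); rewrite /Bad subnKC//.
    (* The radius 2D r^(mN) allows D r^(mN) for truncation and r^(mN) <= D r^(mN) for the diameter
       of the covering set. *)
    have h1 := hd _ _ ht ht0; rewrite edist_proj_line in h1.
    have h2 := prj_coding theta a hr b t (m * N).
    have h3 : q ^+ m = r ^+ (m * N) by rewrite /q -exprM mulnC.
    have h4 : 0 < r ^+ (m * N) by rewrite exprn_gt0.
    rewrite -/x h3 in h1 dqm.
    have h5 : r ^+ (m * N) <= D * r ^+ (m * N) by rewrite ler_peMl// ltW.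
    have -> : prj b (pt (mkseq t (m * N))) - x =
      (prj b (pt (mkseq t (m * N))) - prj b (coding t)) + (prj b (coding t) - x) by ring.
    by apply: le_trans (ler_normD _ _) _; lra.
  - rewrite (nu_prefix_set nu_cyl) (cover_termE s F0 dE) -EFinM -EFinD lee_fin.
    apply: le_trans hm; apply: le_trans (hball m x _); last by rewrite (leq_trans _ m1m)// leq_maxl.
    by apply: le_Ex => // w sw; rewrite -natrM mulnb.
have sub : S `<=` \bigcup_k C k `|` \bigcup_m Bad m.
  move=> t St; have [k _ Fk] := FA _ St.
  have [hb|hb] := pselect (exists m, Bad m t).
    by right; have [m hm] := hb; exists m.
  left; exists k => //; have [_ h _] := hC k; apply: h; first exact/mem_set.
  by move=> m hm; apply: hb; exists m.
have mBad m : measurable (Bad m) by exact: measurable_prefix_set.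
have mC k : measurable (C k) by have [] := hC k.
have mUC : measurable (\bigcup_k C k) by apply: bigcup_measurable.
have mUB : measurable (\bigcup_m Bad m) by apply: bigcup_measurable.
have h1 : (nu (\bigcup_m Bad m) <= e1%:E)%E.
  apply: le_trans (measure_sigma_subadditive nu mBad mUB _) _ => //.
  by apply: le_trans (epsilon_trick0 xpredT (ltW e10)); apply: lee_nneseries => // m _; exact: nuBad.
have h2 : (nu (\bigcup_k C k) <= (e1 + e1)%:E)%E.
  apply: le_trans (measure_sigma_subadditive nu mC mUC _) _ => //.
  apply: le_trans (_ : \sum_(0 <= k <oo) (c%:E * cover_term s (F k) + (e1 / (2 ^ k.+1)%:R)%:E) <= _)%E.
    by apply: lee_nneseries => // k _; have [] := hC k.
  apply: le_trans (epsilon_trick xpredT _ (ltW e10)) _.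
    by move=> k; apply: mule_ge0; [rewrite lee_fin ltW|exact: cover_term_ge0].
  rewrite EFinD leeD2r//.
  rewrite nneseriesZl; last by move=> k _; exact: cover_term_ge0.
  apply: (@le_trans _ _ (c%:E * (e1 / c)%:E)%E).
    by apply: lee_wpmul2l; [rewrite lee_fin ltW|exact: ltW].
  by rewrite -EFinM lee_fin mulrC divfK// gt_eqF.
have : (nu S <= (e1 + e1 + e1)%:E)%E.
  apply: (@le_trans _ _ (nu (\bigcup_k C k `|` \bigcup_m Bad m))).
    by apply: le_measure; rewrite ?inE//; exact: measurableU.
  apply: le_trans (measureU2 _ mUC mUB) _.
  by rewrite (EFinD (e1 + e1)) leeD.
by rewrite v0E lee_fin /e1; lra.
Qed.

Lemma proj_dim_le_image_dim b : (proj_dim b <= image_dim)%E.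
Proof.
rewrite leNgt; apply/negP => /dimH_meas_lt[s [A [s0 st bA nA hA]]].
have lip x y : edist (proj_line b x) (proj_line b y) <= edist x y.
  by rewrite edist_proj_line; exact: prj_lipschitz.
have [B [bB AB hB]] := hmeasure0_lipschitz lip s0 hA.
move: st; rewrite ltNge => /negP; apply.
apply: (@dimH_meas_le _ s B) => //; apply: lt_le_trans nA _.
apply: le_measure; rewrite ?inE; [exact: (coding_borel _ _ hr)|exact: proj_coding_borel|].
by move=> t At; apply: AB; exists (coding t).
Qed.

Lemma proj_dim_le1 b : (proj_dim b <= 1%E)%E.
Proof.
apply/lee_addgt0Pr => e e0; rewrite -EFinD.
pose Seg := proj_line b @` [set x | edist (0, 0) x <= D].
have covers s : 1 < s -> hmeasure s Seg = 0%E.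
  move=> s1; have s0 : 0 <= s by lra.
  apply: hmeasure0_of_balls_pow2 => // delta e' d0 e'0.
  have c0 : 0 < s - 1 by lra.
  have hhalf : 0 < (2^-1 : R) < 1 by lra.
  have [K1 hK1] := expr_eventually_lt D hhalf d0.
  pose z := (2^-1 : R) `^ (s - 1).
  have e40 : 0 < e' / 2 by rewrite divr_gt0.
  have [K2 hK2] := expr_eventually_lt (4 * (2 * D) `^ s) (powR_lt1 hhalf c0) e40.
  pose K := maxn K1 K2; pose M := (2 ^ K)%N.
  have M0 : 0 < M%:R :> R by rewrite ltr0n expn_gt0.
  have MV : M%:R^-1 = 2^-1 ^+ K :> R by rewrite /M natrX exprVn.
  pose rho := D / M%:R.
  have rho0 : 0 < rho by rewrite divr_gt0.
  pose ctr (i : nat) : R * R := ((i%:R * rho - D) * cos b, (i%:R * rho - D) * sin b).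
  (* All discs sit at index 0, with budget e'/2. The factor 4 in the choice of [K2] bounds (2M +
     1)/M. *)
  exists (fun i => if i == 0%N then [seq ctr j | j <- iota 0 (2 * M).+1] else [::]), (fun=> rho).
  have rhod : rho <= delta.
    by rewrite /rho MV; apply/ltW/hK1; rewrite leq_maxl.
  split.
  - by move=> _; rewrite ltW//=.
  - move=> _ [x /= xD <-]; pose u := prj b x.
    have uD : `|u| <= D.
      by apply: le_trans (prj_le_nrm _ _) _; move: xD; rewrite edist2C edist2E /= !subr0 -surjective_pairing.
    have u0 : 0 <= (u + D) / rho.
      by rewrite divr_ge0 ?(ltW rho0)//; move: uD; rewrite ler_norml => /andP[]; lra.
    pose j := Num.truncn ((u + D) / rho).
    have /andP[j1 j2] := truncn_itv u0.
    rewrite -/j ler_pdivlMr// in j1; rewrite -/j ltr_pdivrMr// in j2.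
    exists 0%N, (ctr j); split.
      change (is_true (ctr j \in [seq ctr j | j <- iota 0 (2 * M).+1])).
      apply: (map_f ctr); rewrite mem_iota add0n/= ltnS -(ler_nat R).
      rewrite -(ler_pM2r rho0); apply: le_trans j1 _.
      have -> : (2 * M)%:R * rho = 2 * D by rewrite /rho natrM -mulrA (mulrCA M%:R) divff ?mulr1// gt_eqF.
      by move: uD; rewrite ler_norml => /andP[]; lra.
    have -> : ctr j = proj_line b ((j%:R * rho - D) * cos b, (j%:R * rho - D) * sin b).
      rewrite /ctr /proj_line /=.
      have -> : (j%:R * rho - D) * cos b * cos b + (j%:R * rho - D) * sin b * sin b =
        (j%:R * rho - D) * (cos b ^+ 2 + sin b ^+ 2) by ring.
      by rewrite cos2Dsin2 mulr1.
    rewrite /cball /= edist_proj_line -/u.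
    have -> : prj b ((j%:R * rho - D) * cos b, (j%:R * rho - D) * sin b) = j%:R * rho - D.
      rewrite /prj /=.
      have -> : (j%:R * rho - D) * cos b * cos b + (j%:R * rho - D) * sin b * sin b =
        (j%:R * rho - D) * (cos b ^+ 2 + sin b ^+ 2) by ring.
      by rewrite cos2Dsin2 mulr1.
    by rewrite ler_norml; apply/andP; split; move: j1 j2; rewrite -natr1; lra.
  - case=> [|i] /=; last by rewrite mul0r divr_ge0// ltW.
    rewrite size_map size_iota expn1.
    have hz : 4 * (2 * D) `^ s * z ^+ K < e' / 2 by apply: hK2; rewrite leq_maxr.
    apply: le_trans (ltW hz).
    have -> : 2 * rho = (2 * D) * 2^-1 ^+ K by rewrite /rho -MV; ring.
    rewrite powRM; [|by rewrite mulr_ge0// ltW|by rewrite exprn_ge0].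
    have -> : (2^-1 ^+ K) `^ s = 2^-1 ^+ K * z ^+ K :> R.
      rewrite -(@powR_mulrn _ 2^-1 K)// -(powR_mulrn K (powR_ge0 _ _)) -!powRrM -powRD.
        by congr powR; ring.
      by rewrite (gt_eqF (_ : 0 < 2^-1 :> R)) ?implybT.
    have w0 : 0 <= (2 * D) `^ s * z ^+ K by rewrite mulr_ge0 ?powR_ge0// exprn_ge0// powR_ge0.
    have -> : (2 * M).+1%:R * ((2 * D) `^ s * (2^-1 ^+ K * z ^+ K)) =
       ((2 * M).+1%:R / M%:R) * ((2 * D) `^ s * z ^+ K) by rewrite MV; ring.
    rewrite -[leRHS]mulrA ler_wpM2r// ler_pdivrMr// -natr1 natrM.
    have : 1 <= M%:R :> R by rewrite ler1n expn_gt0.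
    by lra.
have he : 1 < 1 + e by lra.
have lip (x y : R * R) : edist x y <= edist x y by [].
have s0 : 0 <= 1 + e by lra.
(* Used with the identity, to obtain a Borel superset that is still null. *)
have [B [bB AB hB]] := @hmeasure0_lipschitz R _ Seg id lip s0 (covers _ he).
apply: (@dimH_meas_le _ (1 + e) B) => //.
rewrite (_ : coding @^-1` _ = setT) ?nu_setT ?lte_fin//.
apply/seteqP; split => // t _; apply: AB; exists (proj_line b (coding t)) => //.
exists (coding t) => //=.
by have := edist_coding theta a hr t 0; rewrite expr0 mulr1.
Qed.

End ProjectedDimension.

(** * Heavy words bound the dimension from above *)

Section HeavyDimension.
Context {R : realType} {n : nat} (r theta : R) (a : Lam n -> R * R).
Hypothesis hr : 0 < r < 1.
Variables (nu : {measure set (Sigma n) -> \bar R}) (p : nat -> Lam n -> R).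
Hypothesis nu_cyl : forall (w : nat -> Lam n) k, nu (cyl w k) = (\prod_(j < k) p j (w j))%:E.
Hypothesis hp : pvec p.

Let r0 : 0 < r. Proof. by case/andP: hr. Qed.
Let r1 : r < 1. Proof. by case/andP: hr. Qed.
Let rX k : 0 < r ^+ k. Proof. exact: exprn_gt0. Qed.
Local Notation D := (ptbound r a).
Local Notation pt := (pt r theta a).
Local Notation coding := (@coding R n r theta a).
Let D1 : 1 <= D. Proof. exact: ptbound_ge1. Qed.
Let D0 : 0 < D. Proof. exact: lt_le_trans ltr01 D1. Qed.
Local Notation image_dim := (dimH_meas (fun A => nu (coding @^-1` A))).

(** Greedy selection of a maximal c-separated sublist: two of its points in one disc of radius at
    most c/2 would be within c of each other. *)
Lemma separated_subset (c : R) (L : seq (R * R)) : 0 <= c -> exists W : seq (R * R),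
  [/\ {subset W <= L}, forall x, x \in L -> exists2 y, y \in W & edist y x <= c &
      forall z c', 2 * c' <= c -> (\sum_(x <- W) (edist x z <= c')%R <= 1)%N].
Proof.
move=> c0; elim: L => [|x L [W [WL LW Wz]]].
  by exists [::]; split => // z c' _; rewrite big_nil.
have [[y yW yx]|hn] := pselect (exists2 y, y \in W & edist y x <= c).
  exists W; split => //.
    by move=> z /WL zL; rewrite inE zL orbT.
  by move=> z; rewrite inE => /predU1P[->|/LW//]; exists y.
exists (x :: W); split.
- move=> z; rewrite !inE => /predU1P[->|/WL ->]; rewrite ?eqxx ?orbT//.
- move=> z; rewrite inE => /predU1P[->|/LW [y yW yz]].
    by exists x; rewrite ?mem_head// edist2xx.
  by exists y => //; rewrite inE yW orbT.
- move=> z c' hc; rewrite big_cons; have [xz|_] := lerP (edist x z) c'; last exact: Wz.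
  rewrite big_seq big1 // => y yW; apply/eqP; rewrite eqb0; apply/negP => yz.
  apply: hn; exists y => //; have := edist2_triangle z y x.
  by rewrite (edist2C z x); lra.
Qed.

(** Packing: no word is counted in the discs of two separated centres, each disc has mass above r^(J
    tau), and the total mass is 1. *)
Lemma heavy_cover (tau : R) J : exists W : seq (R * R),
  (size W)%:R * r `^ (J%:R * tau) <= 1 /\
  forall w, size w = J -> heavy r theta a tau p J w ->
    exists2 y, y \in W & edist y (pt w) <= 2 * (2 * D + 1) * r ^+ J.
Proof.
pose words := [seq val t | t <- enum {: J.-tuple (Lam n)}].
have mem_words w : size w = J -> w \in words.
  move=> /eqP sw; apply/mapP; exists (Tuple sw) => //; exact: mem_enum.
have c0 : 0 <= 2 * (2 * D + 1) * r ^+ J.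
  by apply: mulr_ge0; [have := D0; lra|exact: ltW].
have [W [WL LW Wz]] :=
  separated_subset [seq pt w | w <- words & heavy r theta a tau p J w] c0.
exists W; split; last first.
  move=> w sw hw; apply: LW; apply: map_f; rewrite mem_filter hw; exact: mem_words.
pose f x := Ex p J (fun w' => (edist x (pt w') <= (2 * D + 1) * r ^+ J)%R%:R).
have hf x : x \in W -> r `^ (J%:R * tau) <= f x.
  by move=> /WL /mapP[w]; rewrite mem_filter => /andP[hw _] ->; exact: ltW.
apply: (@le_trans _ _ (\sum_(x <- W) f x)).
  have -> : (size W)%:R * r `^ (J%:R * tau) = \sum_(x <- W) r `^ (J%:R * tau).
    by rewrite big_const_seq count_predT iter_addr_0 -[RHS]mulr_natl.
  rewrite big_seq [leRHS]big_seq.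
  by apply: ler_sum => x xW; exact: hf.
rewrite -Ex_sum; apply: Ex_le_cst => // w _.
by rewrite -natr_sum lern1; apply: Wz; rewrite mulrA.
Qed.

(** The limsup of the heavy discs has measure at least [eta] by continuity from above, since every
    tail union does. Positive measure suffices, the dimension of a measure being an infimum over
    such sets. *)
Lemma image_dim_le (tau tau' eta : R) : 0 <= tau < tau' -> 0 < eta ->
  (forall m : nat, exists J, (m <= J)%N /\ eta <= heavy_mass r theta a tau p J) ->
  (image_dim <= tau'%:E)%E.
Proof.
move=> /andP[t0 tt'] eta0 hJ.
have t'0 : 0 < tau' by apply: le_lt_trans tt'.
(* Distance from a selected centre to a heavy word, plus D from that word to the coded point, in
   units of r^J. *)
pose E := 2 * (2 * D + 1) + D.
have E0 : 0 < E by rewrite /E; have := D0; lra.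
have dt : 0 < tau' - tau by rewrite subr_gt0.
(* Levels so sparse that the gap between tau and tau' makes the i-th cover cost at most 2^(-i). *)
have /choice[Jf hJf] (i : nat) : exists J, [/\ (i <= J)%N, eta <= heavy_mass r theta a tau p J &
    (2 * E) `^ tau' * (r `^ (tau' - tau)) ^+ J <= 2^-1 ^+ i].
  have h2 : 0 < (2^-1 : R) ^+ i by rewrite exprn_gt0// invr_gt0.
  have [K hK] := expr_eventually_lt ((2 * E) `^ tau') (powR_lt1 hr dt) h2.
  have [J [mJ hJ']] := hJ (maxn i K).
  exists J; split => //; first by rewrite (leq_trans _ mJ)// leq_maxl.
  by apply/ltW/hK; rewrite (leq_trans _ mJ)// leq_maxr.
have /choice[W hW] := fun i => heavy_cover tau (Jf i).
pose rad i := E * r ^+ Jf i.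
have rad0 i : 0 < rad i by rewrite mulr_gt0.
have sizeW i : (size (W i))%:R * (2 * rad i) `^ tau' <= 2^-1 ^+ i.
  have [hs _] := hW i; have [_ _ h3] := hJf i; apply: le_trans h3.
  have -> : 2 * rad i = (2 * E) * r ^+ Jf i by rewrite /rad mulrA.
  have E2 : 0 <= 2 * E by rewrite mulr_ge0// ltW.
  have rJ : 0 <= r ^+ Jf i by exact: ltW.
  rewrite powRM// mulrCA ler_wpM2l ?powR_ge0//.
  have -> : (r ^+ Jf i) `^ tau' = r `^ ((Jf i)%:R * tau) * (r `^ (tau' - tau)) ^+ Jf i.
    rewrite -[(r `^ _) ^+ _]powR_mulrn ?powR_ge0// -(powR_mulrn (Jf i)); last exact: ltW.
    rewrite -!powRrM -powRD; last by rewrite (gt_eqF r0) implybT.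
    by congr powR; ring.
  by rewrite mulrA ler_piMl// exprn_ge0// powR_ge0.
pose B i := \bigcup_j (if (j < size (W i))%N then cball (nth (0, 0) (W i) j) (rad i) else set0).
have inB i x : B i x -> exists2 y, y \in W i & cball y (rad i) x.
  move=> [j _]; case: ifPn => // jW h; exists (nth (0, 0) (W i) j) => //; exact: mem_nth.
pose A := lim_sup_set B.
have bB i : borel2 (B i).
  apply: borel2_bigcup => j; case: ifP => _; first exact: borel2_edist_ball.
  by apply: borel2_open; exact: open0.
have bA : borel2 A.
  apply: borel2_bigcap => m.
  rewrite (_ : \bigcup_(j >= m) B j = \bigcup_j B (m + j)%N); first exact: borel2_bigcup.
  apply/seteqP; split => x.
    by move=> [j /= mj Bj]; exists (j - m)%N => //; rewrite subnKC.
  by move=> [j _ Bj]; exists (m + j)%N => //=; rewrite leq_addr.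
have hA : hmeasure tau' A = 0%E.
  apply: hmeasure0_of_balls_pow2 => [|delta e d0 e0]; first exact: ltW.
  have half : 0 < (2^-1 : R) < 1 by lra.
  have [K1 hK1] := expr_eventually_lt 2 half e0.
  have [K2 hK2] := expr_eventually_lt E hr d0.
  pose m := maxn K1 K2.
  exists (fun i => W (m + i)%N), (fun i => rad (m + i)%N); split.
  - move=> i; rewrite ltW//=; apply: (le_trans _ (ltW (hK2 _ (leq_maxr K1 K2)))).
    rewrite ler_pM2l// ler_wiXn2l// ?ltW//.
    by have [h _ _] := hJf (m + i)%N; rewrite (leq_trans _ h)// leq_addr.
  - move=> x /(_ m I)[j /= mj Bj]; exists (j - m)%N.
    by rewrite subnKC//; have [y yW yx] := inB _ _ Bj; exists y.
  - move=> i; apply: le_trans (sizeW _) _.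
    have h := ltW (hK1 _ (leq_maxl K1 K2)); rewrite -/m in h.
    rewrite exprD natrX exprS !exprVn in h *.
    rewrite ler_pdivlMr ?mulr_gt0 ?exprn_gt0//.
    apply: le_trans h; rewrite le_eqVlt; apply/orP; left; apply/eqP.
    have p1 : (2 ^+ m : R) != 0 by rewrite expf_neq0.
    have p2 : (2 ^+ i : R) != 0 by rewrite expf_neq0.
    by move: (2 ^+ m : R) (2 ^+ i : R) p1 p2 => x y x0 y0; field; rewrite x0.
apply: (@dimH_meas_le _ tau' A) => //; last exact: ltW.
pose S i := prefix_set (Jf i) (heavy r theta a tau p (Jf i)).
have mS i : measurable (S i) by exact: measurable_prefix_set.
have nuS i : (eta%:E <= nu (S i))%E.
  by rewrite (nu_prefix_set nu_cyl) lee_fin; have [] := hJf i.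
have mUS m : measurable (\bigcup_(k >= m) S k) by apply: bigcup_measurable => k _.
apply: (@lt_le_trans _ _ eta%:E); first by rewrite lte_fin.
apply: (@le_trans _ _ (nu (lim_sup_set S))).
  have hc : nu (\bigcup_(k >= m) S k) @[m --> \oo] --> nu (lim_sup_set S).
    apply: lim_sup_set_cvg => //.
    by have := nu_fin nu_cyl (mUS 0%N); rewrite fin_numElt => /andP[].
  rewrite -(cvg_lim _ hc)//; apply: lime_ge; first by apply/cvg_ex; exists (nu (lim_sup_set S)).
  apply: nearW => m; apply: le_trans (nuS m) _.
  apply: le_measure; rewrite ?inE//.
  by move=> s Ss; exists m => //=.
apply: le_measure; rewrite ?inE.
- by apply: bigcap_measurable => // m _; exact: mUS.
- exact: (coding_borel _ _ hr).
move=> s Ss m _; have [j /= mj Sj] := Ss m I.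
exists j => //=; have [_ hWj] := hW j.
have [y yW yx] := hWj _ (size_mkseq _ _) Sj.
exists (index y (W j)) => //; rewrite index_mem yW nth_index//.
have := edist2_triangle (pt (mkseq s (Jf j))) y (coding s).
by have := edist_coding theta a hr s (Jf j); rewrite /cball /= /rad /E; lra.
Qed.

(* All but eta/2 of the prefixes w of length k have mass at least
   (eta/2) (n+1)^-k, which is negligible against r^(-j eps). *)
Lemma heavy_mass_cat (t eps eta : R) k j : 0 <= t -> 0 < eta ->
  (0 < eps) -> (0 < j)%N -> r `^ (j%:R * eps) < eta / 2 / (n.+1%:R ^+ k) ->
  eta <= heavy_mass r theta a t (shp p k) j -> eta <= 1 ->
  eta / 2 <= heavy_mass r theta a (t + eps) p (k + j).
Proof.
move=> t0 eta0 eps0 j0 hj hm eta1.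
pose c := eta / 2 / (n.+1%:R ^+ k).
have nk : 0 < n.+1%:R ^+ k :> R by rewrite exprn_gt0.
have c0 : 0 < c by rewrite divr_gt0// divr_gt0.
have hs := Ex_small_mass k hp (ltW c0).
rewrite card_ord in hs.
have {}hs : Ex p k (fun w => (mass p w < c)%R%:R) <= eta / 2.
  by apply: le_trans hs _; rewrite /c divfK// gt_eqF.
pose H := heavy_mass r theta a t (shp p k) j.
have H1 : H <= 1 by apply: Ex_le_cst; [exact: pvec_shp|move=> w _; rewrite lern1 leq_b1].
apply: (@le_trans _ _ (Ex p k (fun w => H - (mass p w < c)%R%:R))).
  rewrite [leRHS](_ : _ = H - Ex p k (fun w => (mass p w < c)%R%:R)); first by rewrite -/H in hm; lra.
  rewrite (ExD p k (fun=> H) (fun w => - (mass p w < c)%R%:R)) Ex_cst//; congr (_ + _).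
  rewrite -[RHS]mulN1r -ExZ; by apply: eq_Ex => w _; rewrite mulN1r.
rewrite /heavy_mass Ex_cat; apply: le_Ex => // w sw.
case: ltP => [_|cw].
  apply: (@le_trans _ _ 0); first by rewrite subr_le0.
  by apply: Ex_ge0; first exact: pvec_shp.
rewrite subr0; apply: le_Ex; first exact: pvec_shp.
move=> u su; rewrite ler_nat.
case: (boolP (heavy _ _ _ t _ _ _)) => // hu; rewrite lt0b.
rewrite /heavy; apply: (@lt_le_trans _ _ (c * dens r theta a (shp p k) j u)).
  apply: (@lt_trans _ _ (c * r `^ (j%:R * t))); last by rewrite ltr_pM2l.
  apply: (@le_lt_trans _ _ (r `^ (j%:R * eps) * r `^ (j%:R * t))).
    rewrite -powRD; last by rewrite (gt_eqF r0) implybT.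
    apply: powr_le => //; rewrite natrD.
    have : 0 <= k%:R * (t + eps) by rewrite mulr_ge0// addr_ge0// ltW.
    by lra.
  by rewrite ltr_pM2r// powR_gt0.
apply: (@le_trans _ _ (mass p w * dens r theta a (shp p k) j u)).
  apply: ler_wpM2r => //; apply: Ex_ge0; first exact: pvec_shp.
  by [].
rewrite /dens Ex_cat.
apply: le_trans (mass_le_Ex (F := fun w' => Ex (shp p k) j (fun u' =>
   (edist (pt (w ++ u)) (pt (w' ++ u')) <= (2 * D + 1) * r ^+ (k + j))%R%:R)) hp _ sw); last first.
  by move=> w'; apply: Ex_ge0; first exact: pvec_shp.
apply: ler_wpM2l; first exact: mass_ge0.
apply: le_Ex; first exact: pvec_shp.
move=> u' su'; rewrite !pt_cat (edist_wmap _ _ hr) sw.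
by rewrite exprD (mulrCA (2 * D + 1)) (ler_pM2l (rX k)).
Qed.

End HeavyDimension.

(** * Independence on the product space *)

Section ProductSpace.
Context {R : realType} {d : measure_display} {Omega : measurableType d}.
Implicit Types (om : OmegaN Omega) (A B : set (OmegaN Omega)).

Definition seq_shift k om : OmegaN Omega := fun j => om (k + j)%N.
(** Together with measurability, this expresses membership in the sigma-algebra of the first K
    coordinates. *)
Definition determined K A : Prop :=
  forall om om' : OmegaN Omega, (forall j, (j < K)%N -> om j = om' j) -> A om -> A om'.

Lemma measurable_cylOm N (A : nat -> set Omega) : (forall k, measurable (A k)) ->
  measurable (cylOm N A : set (OmegaN Omega)).
Proof. by move=> mA; apply: sub_sigma_algebra; exists N, A. Qed.

Lemma measurable_to_OmegaN (f : OmegaN Omega -> OmegaN Omega) :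
  (forall N (A : nat -> set Omega), (forall k, measurable (A k)) ->
    measurable (f @^-1` cylOm N A)) -> measurable_fun setT f.
Proof.
move=> h _ B mB; rewrite setTI; move: B mB.
rewrite /measurable/=; apply: (@smallest_sub _ _ _ [set B | measurable (f @^-1` B)]).
  split => /=; first by rewrite preimage_set0.
  - by move=> A mA; rewrite setTD preimage_setC; exact: measurableC.
  - by move=> F mF; rewrite preimage_bigcup; exact: bigcup_measurable.
by move=> _ [N [A [mA ->]]]; exact: h.
Qed.

Lemma shift_cylOm k N (A : nat -> set Omega) :
  seq_shift k @^-1` cylOm N A =
  cylOm (k + N) (fun j => if (j < k)%N then setT else A (j - k)%N).
Proof.
apply/seteqP; split => om /=.
  move=> h j jkN; case: ltnP => // kj.
  by have := h (j - k)%N; rewrite /seq_shift subnKC//; apply; lia.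
move=> h j jN; have := h (k + j)%N; rewrite ltn_add2l => /(_ jN).
by rewrite ltnNge leq_addr /= addKn.
Qed.

Lemma measurable_shift k : measurable_fun setT (seq_shift k).
Proof.
apply: measurable_to_OmegaN => N A mA; rewrite shift_cylOm.
by apply: measurable_cylOm => j; case: ifP.
Qed.

Lemma measurable_shift_preimage k A : measurable A -> measurable (seq_shift k @^-1` A).
Proof. by move=> mA; have := @measurable_shift k measurableT _ mA; rewrite setTI. Qed.

Definition truncate K om : OmegaN Omega := fun j => if (j < K)%N then om j else point.

(** The constant padding meets the constraints beyond K either for every sequence or for none. *)
Lemma truncate_cylOm K N (A : nat -> set Omega) :
  truncate K @^-1` cylOm N A = cylOm K (fun j => if (j < N)%N then A j else setT) \/
  truncate K @^-1` cylOm N A = set0.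
Proof.
have [h|h] := pselect (forall j, (K <= j < N)%N -> A j point); [left|right].
  apply/seteqP; split => om /= hom j jN.
    by case: ltnP => // jN'; have := hom j jN'; rewrite /truncate jN.
  rewrite /truncate; case: ltnP => jK; last by apply: h; rewrite jK.
  by have := hom j jK; rewrite jN.
apply/seteqP; split => om //= hom; apply: h => j /andP[Kj jN].
by have := hom j jN; rewrite /truncate ltnNge Kj.
Qed.

Lemma measurable_truncate K : measurable_fun setT (truncate K).
Proof.
apply: measurable_to_OmegaN => N A mA; have [->|->//] := truncate_cylOm K N A.
by apply: measurable_cylOm => j; case: ifP.
Qed.

Lemma truncate_determined K A : determined K A -> truncate K @^-1` A = A.
Proof.
move=> hA; apply/seteqP; split => om /=; apply: hA => j jK; by rewrite /truncate jK.
Qed.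

Lemma setI_closed_cylindersOm : setI_closed (@cylindersOm d Omega).
Proof.
move=> _ _ [N [A [mA ->]]] [M [B [mB ->]]].
exists (maxn N M), (fun j => (if (j < N)%N then A j else setT) `&`
                             (if (j < M)%N then B j else setT)); split.
  by move=> j; apply: measurableI; case: ifP.
apply/seteqP; split => om /=.
  by move=> [h1 h2] j _; split; case: ifP => // h; [exact: h1|exact: h2].
move=> h; split => j jN; have := h j; rewrite leq_max jN ?orbT => /(_ isT)[]//.
Qed.

Variables (P : probability Omega R) (Q : probability (OmegaN Omega) R).
Hypothesis hQ : is_product_measure P Q.

Lemma Q_unique (m1 m2 : {measure set (OmegaN Omega) -> \bar R}) :
  (m1 setT < +oo)%E ->
  (forall N (A : nat -> set Omega), (forall k, measurable (A k)) ->
     m1 (cylOm N A) = m2 (cylOm N A)) ->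
  forall A, measurable A -> m1 A = m2 A.
Proof.
move=> m1oo h A mA.
have cT : cylOm 0 (fun=> setT) = [set: OmegaN Omega] by apply/seteqP.
apply: (@measure_unique _ R (OmegaN Omega) (@cylindersOm d Omega) (fun=> setT)) => //.
- exact: setI_closed_cylindersOm.
- by move=> _; exists 0%N, (fun=> setT).
- by apply/seteqP; split => // x _; exists 0%N.
- by move=> _ [N [B [mB ->]]]; exact: h.
Qed.

Lemma Q_cyl_shift K N (A B : nat -> set Omega) :
  (forall k, measurable (A k)) -> (forall k, measurable (B k)) ->
  Q (cylOm K A `&` seq_shift K @^-1` cylOm N B) = (Q (cylOm K A) * Q (cylOm N B))%E.
Proof.
move=> mA mB.
have -> : cylOm K A `&` seq_shift K @^-1` cylOm N B =
    cylOm (K + N) (fun j => if (j < K)%N then A j else B (j - K)%N).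
  rewrite shift_cylOm; apply/seteqP; split => om /=.
    move=> [h1 h2] j jKN; case: ifP => jK; first exact: h1.
    by have := h2 j jKN; rewrite jK.
  move=> h; split => j jK.
    by have := h j; rewrite jK; apply; rewrite ltn_addr.
  by have := h j jK; case: ifP.
rewrite !hQ//; last by move=> j; case: ifP.
rewrite -EFinM big_split_ord/=; congr (_ * _)%:E; apply: eq_bigr => i _.
  by rewrite ltn_ord.
by rewrite ltnNge leq_addr/= addKn.
Qed.

Lemma Q_fin A : measurable A -> Q A = (fine (Q A))%:E.
Proof. by move=> mA; rewrite fineK// fin_num_measure. Qed.

(** For a fixed cylinder, both sides are finite measures in B, a pushed-forward restriction and a
    multiple of [Q], and they agree on cylinders. *)
Lemma Q_indep_cyl K (A : nat -> set Omega) B : (forall k, measurable (A k)) -> measurable B ->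
  Q (cylOm K A `&` seq_shift K @^-1` B) = (Q (cylOm K A) * Q B)%E.
Proof.
move=> mA mB; have mC : measurable (cylOm K A : set (OmegaN Omega)) by exact: measurable_cylOm.
pose c : {nonneg R} := NngNum (fine_ge0 (measure_ge0 Q (cylOm K A))).
pose m1 := measure_function_pushforward__canonical__measure_function_Measure
  (mrestr Q mC : {measure set _ -> \bar R}) (measurable_shift K).
pose m2 : {measure set (OmegaN Omega) -> \bar R} := mscale c Q.
have h B' : measurable B' -> m1 B' = m2 B'.
  apply: Q_unique => [|N B'' mB''].
    apply: (@le_lt_trans _ _ (Q setT)); last by rewrite probability_setT ltry.
    rewrite /m1 /= /pushforward /mrestr preimage_setT.
    by apply: le_measure; rewrite ?inE//; exact: measurableI.
  rewrite /m1 /m2 /= /pushforward /mrestr /mscale /= -(Q_fin mC) setIC.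
  exact: Q_cyl_shift.
by have := h _ mB; rewrite /m1 /m2 /= /pushforward /mrestr /mscale /= -(Q_fin mC) setIC.
Qed.

(* Truncating the sequence turns A into a cylinder-generated set that only sees
   the first K coordinates, so that uniqueness of measures applies in A too. *)
Lemma Q_indep K A B : measurable A -> determined K A -> measurable B ->
  Q (A `&` seq_shift K @^-1` B) = (Q A * Q B)%E.
Proof.
move=> mA dA mB; have mC := measurable_shift_preimage K mB.
pose c : {nonneg R} := NngNum (fine_ge0 (measure_ge0 Q B)).
pose m1 := measure_function_pushforward__canonical__measure_function_Measure
  (mrestr Q mC : {measure set _ -> \bar R}) (measurable_truncate K).
pose m2 : {measure set (OmegaN Omega) -> \bar R} :=
  mscale c (measure_function_pushforward__canonical__measure_function_Measure
    Q (measurable_truncate K)).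
have h A' : measurable A' -> m1 A' = m2 A'.
  apply: Q_unique => [|N A'' mA''].
    apply: (@le_lt_trans _ _ (Q setT)); last by rewrite probability_setT ltry.
    rewrite /m1 /= /pushforward /mrestr preimage_setT.
    by apply: le_measure; rewrite ?inE//; exact: measurableI.
  rewrite /m1 /m2 /= /pushforward /mrestr /mscale /= -(Q_fin mB) muleC.
  rewrite /pushforward; have [->|->] := truncate_cylOm K N A''.
    by apply: Q_indep_cyl => // j; case: ifP.
  by rewrite set0I measure0 mul0e.
have := h _ mA; rewrite /m1 /m2 /= /pushforward /mrestr /mscale /= -(Q_fin mB) muleC.
by rewrite /pushforward truncate_determined.
Qed.


Lemma fineQ_ge0 A : 0 <= fine (Q A).
Proof. exact: fine_ge0. Qed.

Lemma fineQ_le A B : measurable A -> measurable B -> A `<=` B -> fine (Q A) <= fine (Q B).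
Proof.
move=> mA mB AB; rewrite -lee_fin -!Q_fin//.
by apply: le_measure; rewrite ?inE.
Qed.

Lemma fineQ_le1 A : measurable A -> fine (Q A) <= 1.
Proof. by move=> mA; rewrite -lee_fin -Q_fin// probability_le1. Qed.

Lemma fineQ_setC A : measurable A -> fine (Q (~` A)) = 1 - fine (Q A).
Proof. by move=> mA; rewrite probability_setC// [in LHS](Q_fin mA). Qed.

Lemma fineQ_setU A B : measurable A -> measurable B ->
  fine (Q (A `|` B)) <= fine (Q A) + fine (Q B).
Proof.
move=> mA mB; have mAB := measurableU _ _ mA mB.
by rewrite -lee_fin EFinD -!Q_fin//; exact: measureU2.
Qed.

Lemma fineQ_indep K A B : measurable A -> determined K A -> measurable B ->
  fine (Q (A `&` seq_shift K @^-1` B)) = fine (Q A) * fine (Q B).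
Proof.
by move=> mA dA mB; rewrite (Q_indep mA dA mB) (Q_fin mA) (Q_fin mB).
Qed.

Lemma fineQ0 A : measurable A -> fine (Q A) = 0 -> Q A = 0%E.
Proof. by move=> mA h; rewrite (Q_fin mA) h. Qed.

Section Hits.
Variables (N : nat) (B : nat -> set (OmegaN Omega)).
Hypothesis mB : forall k, measurable (B k).
Hypothesis dB : forall k, determined N (B k).

Definition hits m om : nat := \sum_(0 <= k < m) `[< B k (seq_shift (k * N) om) >].

(** Splitting off the last block leaves an event on the first m blocks intersected with a shifted
    one, the form to which independence applies. *)
Lemma hitsS m c : [set om | (c.+1 <= hits m.+1 om)%N] =
  [set om | (c.+1 <= hits m om)%N] `|` ([set om | (c <= hits m om)%N] `&` seq_shift (m * N) @^-1` B m).
Proof.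
apply/seteqP; split => om /=; rewrite /hits big_nat_recr//=.
  case: asboolP => h; rewrite ?addn0 ?addn1; last by left.
  by rewrite ltnS; right.
move=> [h|[h /asboolP hB]]; first by rewrite (leq_trans h)// leq_addr.
by rewrite hB addn1 ltnS.
Qed.

Lemma measurable_hits m c : measurable [set om | (c <= hits m om)%N].
Proof.
elim: m c => [|m IH] [|c]; rewrite ?hitsS.
- by rewrite (_ : [set _ | _] = setT)//; apply/seteqP; split.
- rewrite (_ : [set _ | _] = set0)//; apply/seteqP; split => // om /=.
  by rewrite /hits big_nil.
- by rewrite (_ : [set _ | _] = setT)//; apply/seteqP; split.
- apply: measurableU; first exact: IH.
  by apply: measurableI; [exact: IH|exact: measurable_shift_preimage].
Qed.

Lemma determined_hits m c : determined (m * N) [set om | (c <= hits m om)%N].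
Proof.
move=> om om' h /=; have -> // : hits m om = hits m om'.
rewrite /hits !big_mkord; apply: eq_bigr => k _; congr nat_of_bool.
have hk j : (j < N)%N -> seq_shift (k * N) om j = seq_shift (k * N) om' j.
  move=> jN; apply: h; have := ltn_ord k; nia.
by apply/asboolP/asboolP; apply: dB => j jN; rewrite hk.
Qed.

(** Chernoff's bound by induction on tails instead of integration: multiplied by L^(c+1), the
    recursion [hitsS] gains one factor 1 + L Q(B m). *)
Lemma hits_tail m c (L : R) : 1 <= L ->
  fine (Q [set om | (c <= hits m om)%N]) * L ^+ c <= \prod_(0 <= k < m) (1 + L * fine (Q (B k))).
Proof.
move=> L1; have L0 : 0 <= L by lra.
have prod1 m' : 1 <= \prod_(0 <= k < m') (1 + L * fine (Q (B k))).
  elim: m' => [|m' IH]; first by rewrite big_nil.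
  rewrite big_nat_recr//= -[leLHS]mulr1; apply: ler_pM => //.
  by rewrite lerDl; apply: mulr_ge0 => //; exact: fineQ_ge0.
elim: m c => [|m IH] [|c].
- by rewrite expr0 mulr1 big_nil fineQ_le1//; exact: measurable_hits.
- rewrite (_ : [set _ | _] = set0) ?measure0 ?mul0r ?big_nil//.
  by apply/seteqP; split => // om /=; rewrite /hits big_nil.
- by rewrite expr0 mulr1 (le_trans (fineQ_le1 _))//; exact: measurable_hits.
have mE : measurable (seq_shift (m * N) @^-1` B m) by exact: measurable_shift_preimage.
rewrite hitsS big_nat_recr//=.
apply: (@le_trans _ _ ((fine (Q [set om | (c.+1 <= hits m om)%N]) +
    fine (Q [set om | (c <= hits m om)%N]) * fine (Q (B m))) * L ^+ c.+1)).
  rewrite ler_wpM2r ?exprn_ge0//.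
  have mI := measurableI _ _ (measurable_hits m c) mE.
  apply: le_trans (fineQ_setU (measurable_hits m c.+1) mI) _.
  by rewrite lerD2l fineQ_indep//; [exact: measurable_hits|exact: determined_hits].
rewrite mulrDl mulrDr mulr1; apply: lerD; first exact: IH.
rewrite exprS.
have -> : fine (Q [set om | (c <= hits m om)%N]) * fine (Q (B m)) * (L * L ^+ c) =
  (fine (Q [set om | (c <= hits m om)%N]) * L ^+ c) * (L * fine (Q (B m))) by ring.
by rewrite ler_wpM2r// mulr_ge0// fineQ_ge0.
Qed.

Lemma hits_exp M m : (0 < M)%N ->
  \sum_(0 <= k < m) fine (Q (B k)) <= m%:R * expR (- (2 * M%:R)) ->
  fine (Q [set om | (m <= M * hits m om)%N]) <= expR (- m%:R).
Proof.
move=> M0 hs.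
have ex : exists c, (m <= M * c)%N by exists m; rewrite leq_pmull.
(* Here c is m/M rounded up, which turns the event into a tail of [hits]. *)
have [c hc cmin] := ex_minnP ex.
have -> : [set om | (m <= M * hits m om)%N] = [set om | (c <= hits m om)%N].
  apply/seteqP; split => om /=; first exact: cmin.
  by move=> h; apply: leq_trans hc _; rewrite leq_mul2l h orbT.
pose L := expR (2 * M%:R) : R.
have L1 : 1 <= L by rewrite -expR0 ler_expR mulr_ge0.
have L0 : 0 < L by lra.
have h := hits_tail m c L1.
have hp : \prod_(0 <= k < m) (1 + L * fine (Q (B k))) <= expR (m%:R).
  apply: (@le_trans _ _ (expR (\sum_(0 <= k < m) L * fine (Q (B k))))).
    rewrite expR_sum; apply: ler_prod => k _; rewrite expR_ge1Dx andbT.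
    by rewrite addr_ge0// mulr_ge0 ?fineQ_ge0// ltW.
  rewrite ler_expR -mulr_sumr; apply: le_trans (ler_wpM2l (ltW L0) hs) _.
  by rewrite mulrCA /L -expRD subrr expR0 mulr1.
have hL : expR (2 * m%:R) <= L ^+ c.
  rewrite /L -expRM_natr ler_expR -mulrA ler_pM2l// -natrM ler_nat//.
have e2 : 0 < expR (2 * m%:R) :> R by exact: expR_gt0.
rewrite -(ler_pM2r e2) -expRD.
apply: (@le_trans _ _ (expR m%:R)); last by rewrite ler_expR; lra.
by apply: le_trans (le_trans h hp); rewrite ler_wpM2l ?fineQ_ge0.
Qed.

Lemma ae_few_hits M m0 : (0 < M)%N ->
  (forall m, (m0 <= m)%N -> \sum_(0 <= k < m) fine (Q (B k)) <= m%:R * expR (- (2 * M%:R))) ->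
  {ae Q, forall om, exists m1, forall m, (m1 <= m)%N -> (M * hits m om < m)%N}.
Proof.
move=> M0 hs.
pose Z m : set (OmegaN Omega) := [set om | (m0 + m <= M * hits (m0 + m) om)%N].
have mZ m : measurable (Z m).
  have [c hc] : exists c, Z m = [set om | (c <= hits (m0 + m) om)%N].
    have ex : exists c, (m0 + m <= M * c)%N by exists (m0 + m)%N; rewrite leq_pmull.
    have [c hc cmin] := ex_minnP ex; exists c.
    apply/seteqP; split => om /=; first exact: cmin.
    by move=> h; apply: leq_trans hc _; rewrite leq_mul2l h orbT.
  by rewrite hc; exact: measurable_hits.
have hZ : Q (lim_sup_set Z) = 0%E.
  apply: lim_sup_set_cvg0 => //; apply: (@le_lt_trans _ _ 2%:E); last by rewrite ltry.
  apply: le_trans (epsilon_trick0 xpredT (_ : 0 <= 2)) => //.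
  apply: lee_nneseries => [m _ _|m _]; first exact: measure_ge0.
  rewrite [leLHS](Q_fin (mZ m)) lee_fin.
  apply: le_trans (hits_exp M0 (hs _ (leq_addr _ _))) _.
  apply: (@le_trans _ _ (expR (- m%:R))); first by rewrite ler_expR lerN2 ler_nat leq_addl.
  apply: le_trans (expRN_le_pow2 m) _.
  by rewrite !natrX exprS invfM mulrA divff// mul1r.
exists (lim_sup_set Z); split => //.
  by apply: bigcap_measurable => // m _; apply: bigcup_measurable.
move=> om /= hom m _; apply: contra_notP hom => hn.
exists (m0 + m)%N => k hk; rewrite ltnNge; apply/negP => h; apply: hn.
exists (k - m0)%N => /=; first by lia.
by rewrite /Z /= subnKC//; lia.
Qed.

End Hits.

(** The windows from k i to k i + j i are disjoint, so avoiding M consecutive events has probability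
    at most (1 - eta)^M. *)
Lemma ae_infinitely_often (k j : nat -> nat) (G : nat -> set (OmegaN Omega)) (eta : R) :
  (forall i, k i.+1 = (k i + j i)%N) -> (forall i, measurable (G i)) ->
  (forall i, determined (j i) (G i)) -> 0 < eta < 1 ->
  (forall i, eta <= fine (Q (G i))) ->
  {ae Q, forall om, forall m, exists i, (m <= i)%N /\ G i (seq_shift (k i) om)}.
Proof.
move=> hk mG dG /andP[eta0 eta1] hG; apply: ae_foralln => m.
pose V M : set (OmegaN Omega) :=
  [set om | forall i, (m <= i < m + M)%N -> ~ G i (seq_shift (k i) om)].
have VS M : V M.+1 = V M `&` seq_shift (k (m + M)) @^-1` (~` G (m + M)%N).
  apply/seteqP; split => om /=.
    move=> h; split; first by move=> i /andP[h1 h2]; apply: h; lia.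
    by apply: h; lia.
  move=> [h1 h2] i /andP[h3 h4].
  have [->//|ne] := eqVneq i (m + M)%N; apply: h1; lia.
have mS M : measurable (seq_shift (k (m + M)) @^-1` (~` G (m + M)%N)).
  by apply: measurable_shift_preimage; exact: measurableC.
have mV M : measurable (V M).
  elim: M => [|M IH]; last by rewrite VS; exact: measurableI.
  rewrite (_ : V 0%N = setT)//; apply/seteqP; split => // om _ i; lia.
have kmono i i' : (i <= i')%N -> (k i <= k i')%N.
  move=> /subnKC <-; elim: (i' - i)%N => [|l IHl]; first by rewrite addn0.
  by rewrite addnS hk (leq_trans IHl)// leq_addr.
have dV M : determined (k (m + M)) (V M).
  move=> om om' h hV i /andP[h1 h2] hGi; apply: (hV i); first by rewrite h1.
  apply: dG hGi => l lj; rewrite /seq_shift; apply/esym/h.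
  by apply: leq_trans (kmono i.+1 (m + M)%N h2); rewrite hk ltn_add2l.
have hV M : fine (Q (V M)) <= (1 - eta) ^+ M.
  elim: M => [|M IH]; first by rewrite expr0 fineQ_le1.
  have mC := measurableC (mG (m + M)%N).
  rewrite VS (fineQ_indep (mV M) (dV M) mC) fineQ_setC// exprSr.
  apply: ler_pM => //; rewrite ?fineQ_ge0 ?subr_ge0 ?fineQ_le1//.
  by rewrite lerD2l lerN2.
pose Z := \bigcap_M V M.
have mZ : measurable Z by apply: bigcap_measurable.
exists Z; split => //.
  apply: fineQ0 => //; apply/eqP; rewrite eq_le fineQ_ge0 andbT leNgt; apply/negP => Z0.
  have e1 : 0 < 1 - eta < 1 by lra.
  have [M hM] := expr_eventually_lt 1 e1 Z0.
  have := hM M (leqnn M); rewrite mul1r ltNge => /negP; apply.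
  by apply: le_trans (hV M); apply: fineQ_le => // om; apply.
move=> om /= hn M _ i /andP[mi _] hGi; apply: hn; exists i; split => //.
Qed.

End ProductSpace.

(** * Expected counts, measurability of the environment events, and stability under a change of
    angle *)

Section SumMeasure.
(** The sum of probabilities is the expected number of occurrences, so a count valid in every
    environment can be integrated. *)
Lemma sum_measure_le {R : realType} d (T : measurableType d) (Q : probability T R)
  (C : nat -> set T) m (c : R) : (forall k, measurable (C k)) -> 0 <= c ->
  (forall x, \sum_(0 <= k < m) \1_(C k) x <= c) ->
  \sum_(0 <= k < m) fine (Q (C k)) <= c.
Proof.
move=> mC c0 h; rewrite -lee_fin -sumEFin.
have -> : (\sum_(0 <= k < m) (fine (Q (C k)))%:E = \int[Q]_x (\sum_(0 <= k < m) (\1_(C k) x)%:E))%E.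
  rewrite ge0_integral_sum//; last first.
    by move=> k; apply/measurable_EFinP; exact: measurable_indic.
  apply: eq_bigr => k _; rewrite integral_indic// setIT.
  by rewrite fineK// fin_num_measure.
apply: (@le_trans _ _ (\int[Q]_x (c%:E))%E).
  apply: ge0_le_integral => //.
  - by move=> x _; apply: sume_ge0 => k _; rewrite lee_fin.
  - by apply: emeasurable_sum => k; apply/measurable_EFinP; exact: measurable_indic.
  - by move=> x _; rewrite sumEFin lee_fin.
rewrite integral_cst// [X in (_ * X)%E](_ : _ = 1%E) ?mule1//; exact: probability_setT.
Qed.
End SumMeasure.

Section Measurability.
Context {R : realType} {n : nat} (r theta : R) (a : Lam n -> R * R).
Context {d : measure_display} {Omega : measurableType d} (X : Omega -> Lam n -> R).
Hypothesis mX : forall i, measurable_fun setT (fun w => X w i).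
Implicit Types om : OmegaN Omega.

Definition pom om : nat -> Lam n -> R := fun j => X (om j).

Lemma measurable_coordinate j : measurable_fun setT (fun om : OmegaN Omega => om j).
Proof.
move=> _ A mA; rewrite setTI.
have -> : (fun om : OmegaN Omega => om j) @^-1` A =
    cylOm j.+1 (fun i => if i == j then A else setT).
  apply/seteqP; split => om /=.
    by move=> h i _; case: eqVneq => // ->.
  by move=> /(_ j (ltnSn j)); rewrite eqxx.
by apply: measurable_cylOm => i; case: ifP.
Qed.

Lemma measurable_Ex k (F : OmegaN Omega -> seq (Lam n) -> R) :
  (forall w, measurable_fun setT (fun om => F om w)) ->
  measurable_fun setT (fun om => Ex (pom om) k (F om)).
Proof.
(* The starting coordinate is generalised because [Ex] shifts the environment at each letter. *)
suff h c : (forall w, measurable_fun setT (fun om => F om w)) ->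
    measurable_fun setT (fun om => Ex (fun j => X (om (c + j)%N)) k (F om)) by exact: (h 0%N).
elim: k c F => [|k IH] c F mF /=; first exact: mF.
apply: measurable_sum => i; apply: measurable_funM.
  exact: (measurableT_comp (mX i) (@measurable_coordinate (c + 0)%N)).
have e : (fun om : OmegaN Omega => Ex (fun j => X (om (c + j.+1)%N)) k (fun w => F om (i :: w))) =
    (fun om => Ex (fun j => X (om (c.+1 + j)%N)) k (fun w => F om (i :: w))).
  by apply/funext => om; apply: eq_Exp => j i' _; rewrite addnS.
by rewrite e; apply: IH => w; exact: mF.
Qed.

Lemma measurable_ltr_natr (f : OmegaN Omega -> R) (c : R) :
  measurable_fun setT f -> measurable_fun setT (fun om => (c < f om)%R%:R : R).
Proof.
move=> mf.
have -> : (fun om => (c < f om)%R%:R : R) = (fun om => if c < f om then 1 else 0).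
  by apply/funext => om; case: (c < f om).
by apply: measurable_fun_ifT => //; apply: measurable_fun_ltr.
Qed.

Lemma measurable_gt_set (f : OmegaN Omega -> R) (c : R) :
  measurable_fun setT f -> measurable [set om | c < f om].
Proof.
move=> mf; have := @measurable_fun_ltr _ _ R setT (fun=> c) f (measurable_cst _) mf.
by move=> /(_ measurableT [set true] I); rewrite setTI.
Qed.

Definition heavy_event (t eta : R) j : set (OmegaN Omega) :=
  [set om | eta < heavy_mass r theta a t (pom om) j].
Definition bad_event (kappa rho b : R) N (e : R) : set (OmegaN Omega) :=
  [set om | e < bad_word_mass r theta a kappa rho b N (pom om)].

Lemma measurable_heavy_event t eta j : measurable (heavy_event t eta j).
Proof.
apply: measurable_gt_set; apply: measurable_Ex => w.
by apply: measurable_ltr_natr; apply: measurable_Ex.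
Qed.

Lemma measurable_bad_event kappa rho b N e : measurable (bad_event kappa rho b N e).
Proof.
apply: measurable_gt_set; apply: measurable_Ex => w.
by apply: measurable_ltr_natr; apply: measurable_Ex.
Qed.

Lemma determined_heavy_event t eta j : determined j (heavy_event t eta j).
Proof.
move=> om om' h; rewrite /heavy_event /=.
have e k (F : seq (Lam n) -> R) : (k <= j)%N -> Ex (pom om) k F = Ex (pom om') k F.
  by move=> kj; apply: eq_Exp => i i' ik; rewrite /pom h// (leq_trans ik).
have -> // : heavy_mass r theta a t (pom om) j = heavy_mass r theta a t (pom om') j.
by rewrite /heavy_mass e//; apply: eq_Ex => w _; rewrite /heavy /dens e.
Qed.

Lemma determined_bad_event kappa rho b N e : determined N (bad_event kappa rho b N e).
Proof.
move=> om om' h; rewrite /bad_event /=.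
have ee k (F : seq (Lam n) -> R) : (k <= N)%N -> Ex (pom om) k F = Ex (pom om') k F.
  by move=> kj; apply: eq_Exp => i i' ik; rewrite /pom h// (leq_trans ik).
have -> // : bad_word_mass r theta a kappa rho b N (pom om) = bad_word_mass r theta a kappa rho b N (pom om').
by rewrite /bad_word_mass ee//; apply: eq_Ex => w _; rewrite /bad_word /slab ee.
Qed.

End Measurability.

Section Robustness.
Context {R : realType} {n : nat} (r theta : R) (a : Lam n -> R * R).
Hypothesis hr : 0 < r < 1.
Local Notation D := (ptbound r a).

(** Points of words are at most 2D apart, so changing the angle by r^N changes the difference of
    projections by at most 4D r^N: hence 10 = 6 + 4. *)
Lemma bad_mass_angle (rho b c : R) N (p : nat -> Lam n -> R) : pvec p -> `|b - c| <= r ^+ N ->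
  bad_word_mass r theta a (6 * D) rho b N p <= bad_word_mass r theta a (10 * D) rho c N p.
Proof.
move=> hp bc; have D0 : 0 < D := lt_le_trans ltr01 (ptbound_ge1 a hr).
apply: le_Ex => // u su; rewrite ler_nat.
case: (boolP (bad_word _ _ _ (6 * D) _ _ _ _ _)) => // h; rewrite lt0b.
rewrite /bad_word; apply: lt_le_trans h _.
apply: le_Ex => // u' su'; rewrite ler_nat.
case: (lerP `|prj b _ - _|) => // h; rewrite lt0b; move: h.
rewrite !prjB; set v := (_, _) => h.
have hv : nrm v <= 2 * D.
  rewrite (_ : nrm v = edist (pt r theta a u) (pt r theta a u'))//.
  apply: le_trans (edist2_triangle (0, 0) _ _) _.
  rewrite edist2C; have := edist_pt theta a hr u; have := edist_pt theta a hr u'; lra.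
have h2 := prj_angle_lipschitz b c v.
have h3 : 2 * nrm v * `|b - c| <= 4 * D * r ^+ N.
  apply: ler_pM => //; first by rewrite mulr_ge0// nrm_ge0.
  by lra.
have h4 : `|prj c v| <= `|prj b v| + `|prj b v - prj c v|.
  rewrite -lerBlDl; apply: le_trans (lerB_dist _ _) _.
  by rewrite distrC.
by lra.
Qed.

End Robustness.

(** * Almost sure statements *)

Section RandomMeasure.
Context {R : realType} {n : nat} (r theta : R) (a : Lam n -> R * R).
Context {d : measure_display} {Omega : measurableType d}.
Variables (P : probability Omega R) (X : Omega -> Lam n -> R).
Variables (Q : probability (OmegaN Omega) R).
Variable nu : (nat -> Omega) -> {measure set (Sigma n) -> \bar R}.
Hypothesis hr : 0 < r < 1.
Hypothesis theta_irr : ~ (exists q : rat, theta / pi = ratr q).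
Hypothesis mX : forall i, measurable_fun setT (fun w => X w i).
Hypothesis hX : forall w, (forall i, 0 <= X w i <= 1) /\ \sum_i X w i = 1.
Hypothesis hQ : is_product_measure P Q.
Hypothesis nu_cyl : forall (om : nat -> Omega) (w : nat -> Lam n) (k : nat),
  nu om (cyl w k) = (\prod_(j < k) X (om j) (w j))%:E.

Let r0 : 0 < r. Proof. by case/andP: hr. Qed.
Let r1 : r < 1. Proof. by case/andP: hr. Qed.
Local Notation D := (ptbound r a).
Let D0 : 0 < D. Proof. exact: lt_le_trans ltr01 (ptbound_ge1 a hr). Qed.
Local Notation coding := (@coding R n r theta a).
Local Notation image_dim om := (dimH_meas (fun A => nu om (coding @^-1` A))).
Local Notation proj_dim om b :=
  (dimH_meas (fun A => nu om (coding @^-1` (proj_line b @^-1` A)))).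
Local Notation heavy_event := (heavy_event r theta a X).
Local Notation bad_event := (bad_event r theta a X).

Lemma pvec_pom om : pvec (pom X om).
Proof.
by move=> j; have [h1 h2] := hX (om j); split => // i; have /andP[] := h1 i.
Qed.

Lemma rotation_irrational N : (0 < N)%N ->
  forall (q : nat) (m : int), (0 < q)%N -> q%:R * (N%:R * theta) <> m%:~R * pi.
Proof.
move=> N0 q m q0 h; apply: theta_irr; exists (m%:~R / (q * N)%:R).
have qN : (q * N)%:R != 0 :> R by rewrite pnatr_eq0 -lt0n muln_gt0 q0.
rewrite fmorph_div/= ratr_int ratr_nat; apply/eqP.
have pin : pi != 0 :> R by rewrite gt_eqF// pi_gt0.
rewrite (eqr_div _ _ pin qN); apply/eqP.
transitivity (q%:R * (N%:R * theta)); last exact: h.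
by rewrite natrM; ring.
Qed.

Lemma exists_inv_le (x : R) : 0 < x -> exists M : nat, (0 < M)%N /\ M%:R^-1 <= x.
Proof.
move=> x0; exists (Num.truncn x^-1).+1; split => //.
rewrite invf_ple ?posrE//; exact/ltW/truncnS_gt.
Qed.

(** One [eps] pays for the mass of the prefix before a heavy window, the other is the gap that
    [image_dim_le] asks for. *)
Lemma ae_image_dim_le (t eps eta : R) : 0 <= t -> 0 < eps -> 0 < eta < 1 ->
  (forall J : nat, exists j, (J <= j)%N /\ eta <= fine (Q (heavy_event t eta j))) ->
  {ae Q, forall om : OmegaN Omega, (image_dim om <= (t + eps + eps)%:E)%E}.
Proof.
move=> t0 eps0 /andP[eta0 eta1] hJ.
have /choice[jj hjj] (k : nat) : exists j, [/\ (0 < j)%N,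
    r `^ (j%:R * eps) < eta / 2 / (n.+1%:R ^+ k) & eta <= fine (Q (heavy_event t eta j))].
  have e0 : 0 < eta / 2 / (n.+1%:R ^+ k) by rewrite !divr_gt0// exprn_gt0.
  have [K hK] := expr_eventually_lt 1 (powR_lt1 hr eps0) e0.
  have [j [hj hQj]] := hJ (maxn K 1); exists j; split => //.
    by rewrite (leq_trans _ hj)// leq_maxr.
  rewrite mulrC powRrM powR_mulrn ?powR_ge0// -[ltLHS]mul1r.
  by apply: hK; rewrite (leq_trans _ hj)// leq_maxl.
(* Each window begins where the previous one ends and is long enough to make the prefix before it
   negligible. *)
pose kf i := iter i (fun k => k + jj k)%N 0%N.
have kfS i : kf i.+1 = (kf i + jj (kf i))%N by [].
have kfi i : (i <= kf i)%N.
  elim: i => // i IH; rewrite kfS; have [h _ _] := hjj (kf i); lia.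
have := @ae_infinitely_often _ _ _ _ _ hQ kf (fun i => jj (kf i))
  (fun i => heavy_event t eta (jj (kf i))) eta kfS.
have h1 : 0 < eta < 1 by rewrite eta0.
move=> /(_ (fun i => measurable_heavy_event r theta a mX t eta (jj (kf i)))).
move=> /(_ (fun i => @determined_heavy_event _ _ r theta a _ _ X t eta (jj (kf i))) h1).
move=> /(_ (fun i => match hjj (kf i) with And3 _ _ h => h end)).
apply: filterS => om hom.
have lt2 : 0 <= t + eps < t + eps + eps by rewrite addr_ge0 ?(ltW eps0)//= ltrDl.
apply: (image_dim_le hr (nu_cyl om) (pvec_pom om) lt2 (_ : 0 < eta / 2)); first by rewrite divr_gt0.
move=> m; have [i [mi hi]] := hom m.
exists (kf i + jj (kf i))%N; split; first by rewrite (leq_trans mi)// (leq_trans (kfi i))// leq_addr.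
have [j0 hj _] := hjj (kf i).
by apply: (heavy_mass_cat hr (pvec_pom om)) => //; exact: ltW.
Qed.

Section LightCase.
Variables (t eps : R).
Hypothesis t01 : 0 < t < 1.
Hypothesis hQt : forall eta : R, 0 < eta ->
  exists J : nat, forall j, (J <= j)%N -> fine (Q (heavy_event t eta j)) <= eta.

(* On the event that no scale is heavy, equidistribution bounds the number of
   bad angles pointwise; integrating gives the bound on probabilities. *)
Lemma sum_bad_event_le (l L : nat) (e rho eta : R) : (0 < l)%N -> (0 < L)%N -> 0 < e ->
  0 < rho -> 0 < eta ->
  (forall j, (L <= j)%N -> fine (Q (heavy_event t eta j)) <= eta) ->
  exists c : R, forall b m,
  \sum_(0 <= k < m) fine (Q (bad_event (10 * D) rho (b - k%:R * ((l * L)%:R * theta)) (l * L) e))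
   <= m%:R * (l%:R * eta + e^-1 * (l%:R * eta +
        rho^-1 * ((1 + 16 * (10 * D) * l%:R) * r `^ ((l * L)%:R * t - L%:R)))) + c.
Proof.
move=> l0 L0 e0 rho0 eta0 hL.
have t01' : 0 <= t <= 1 by case/andP: t01 => h1 h2; rewrite !ltW.
have k0 : 0 < 10 * D by rewrite mulr_gt0.
have NL0 : (0 < l * L)%N by rewrite muln_gt0 l0.
have [q0 hq] := sum_bad_mass_le theta a hr L t01' k0 l0 (rotation_irrational NL0).
exists (e^-1 * (rho^-1 * (l * q0)%:R)) => b m.
pose B k := bad_event (10 * D) rho (b - k%:R * ((l * L)%:R * theta)) (l * L) e.
have mB k : measurable (B k) by exact: measurable_bad_event.
pose U := \big[setU/set0]_(i < l) heavy_event t eta (i.+1 * L).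
have mU : measurable U by apply: bigsetU_measurable => i _; exact: measurable_heavy_event.
have QU : fine (Q U) <= l%:R * eta.
  rewrite -lee_fin -(Q_fin Q mU).
  apply: le_trans (@Boole_inequality _ _ _ Q (fun i => heavy_event t eta (i.+1 * L)) l _) _.
    by move=> i _; exact: measurable_heavy_event.
  apply: (@le_trans _ _ (\sum_(i < l) eta%:E)%E).
    apply: lee_sum => i _; rewrite [leLHS](Q_fin Q); last exact: measurable_heavy_event.
    by rewrite lee_fin; apply: hL; rewrite leq_pmull.
  by rewrite sumEFin lee_fin sumr_const card_ord mulr_natl.
pose K := l%:R * eta +
  rho^-1 * ((1 + 16 * (10 * D) * l%:R) * r `^ ((l * L)%:R * t - L%:R)).
have K0 : 0 <= K.
  rewrite addr_ge0//; first by rewrite mulr_ge0// ltW.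
  rewrite mulr_ge0// ?invr_ge0 ?(ltW rho0)//; rewrite mulr_ge0 ?powR_ge0//.
  by rewrite addr_ge0// mulr_ge0// mulr_ge0// ltW.
have hC : \sum_(0 <= k < m) fine (Q (B k `&` ~` U)) <=
    e^-1 * (m%:R * K + rho^-1 * (l * q0)%:R).
  have mC k : measurable (B k `&` ~` U) by apply: measurableI => //; exact: measurableC.
  apply: sum_measure_le => //.
    by rewrite mulr_ge0 ?invr_ge0 ?(ltW e0)// addr_ge0 ?mulr_ge0// invr_ge0 ltW.
  move=> om; have [omU|omU] := pselect (U om).
    rewrite big1; first by rewrite mulr_ge0 ?invr_ge0 ?(ltW e0)// addr_ge0 ?mulr_ge0// invr_ge0 ltW.
    by move=> k _; rewrite indicE memNset//= => -[_]; exact.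
  apply: (@le_trans _ _ (e^-1 * \sum_(0 <= k < m)
      bad_word_mass r theta a (10 * D) rho (b - k%:R * ((l * L)%:R * theta)) (l * L) (pom X om))).
    rewrite mulr_sumr; apply: ler_sum => k _; rewrite indicE.
    case: (boolP (om \in _)) => [/set_mem[hB _]|_].
      by rewrite mulrC ler_pdivlMr// mul1r; exact: ltW.
    rewrite mulr_ge0 ?invr_ge0 ?(ltW e0)//.
    by apply: Ex_ge0 => //; exact: pvec_pom.
  rewrite ler_pM2l ?invr_gt0//; apply: le_trans (hq _ b rho m (pvec_pom om) rho0) _.
  rewrite lerD2r ler_wpM2l// lerD2r.
  apply: (@le_trans _ _ (\sum_(i < l) eta)); last by rewrite sumr_const card_ord mulr_natl.
  apply: ler_sum => i _; rewrite leNgt; apply/negP => h; apply: omU.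
  by rewrite /U (bigD1 i)//=; left.
apply: (@le_trans _ _ (\sum_(0 <= k < m) (fine (Q (B k `&` ~` U)) + l%:R * eta))).
  apply: ler_sum => k _.
  have mC : measurable (B k `&` ~` U) by apply: measurableI => //; exact: measurableC.
  apply: (@le_trans _ _ (fine (Q ((B k `&` ~` U) `|` U)))).
    apply: fineQ_le; [exact: mB|exact: measurableU|].
    by move=> om hB; have [h|h] := pselect (U om); [right|left].
  by apply: le_trans (fineQ_setU Q mC mU) _; rewrite lerD2l.
rewrite big_split /= sumr_const_nat subn0 -[l%:R * eta *+ m]mulr_natl.
by move: hC; rewrite -/K; lra.
Qed.

Hypothesis heps : 0 < eps < t.

(** The constants are fixed backwards: l and M limit the loss in the exponent, M determines the
    tolerated bad mass, M' the tolerated proportion of bad environments, these give [eta], and L is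
    taken large last. *)
Lemma ae_proj_dim_ge :
  {ae Q, forall om : OmegaN Omega, forall b : R, 0 <= b < pi -> ((t - eps)%:E <= proj_dim om b)%E}.
Proof.
have /andP[t0 t1] := t01; have /andP[eps0 epst] := heps.
have [l [l0 hl]] := @exists_inv_le (eps / 8) (divr_gt0 eps0 (ltr0Sn _ _)).
have [M [M0 hM]] := @exists_inv_le (eps / 4) (divr_gt0 eps0 (ltr0Sn _ _)).
have lR : 0 < l%:R :> R by rewrite ltr0n.
have l2 : 2 <= l%:R * (eps / 4).
  by move: hl; rewrite -[l%:R^-1]mul1r ler_pdivrMr//; lra.
(* The mean bad mass per block allowed by [Ex_many_bad]. One half is spent inside ordinary blocks,
   the other on the proportion 1/M' of bad environment blocks. *)
pose e0 := expR (- (2 * M%:R)) : R.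
have e00 : 0 < e0 by exact: expR_gt0.
have [M' [M'0 hM']] := @exists_inv_le (e0 / 2) (divr_gt0 e00 (ltr0Sn _ _)).
pose e1 := expR (- (2 * M'%:R)) : R.
have e10 : 0 < e1 by exact: expR_gt0.
pose e2 := e0 / 2; have e20 : 0 < e2 by rewrite divr_gt0.
pose eta := e1 / 4 / (l%:R * (1 + e2^-1)).
have c0 : 0 < l%:R * (1 + e2^-1) by rewrite mulr_gt0// addr_gt0// invr_gt0.
have eta0 : 0 < eta by rewrite divr_gt0// divr_gt0.
have etaE : l%:R * eta + e2^-1 * (l%:R * eta) = e1 / 4.
  have -> : l%:R * eta + e2^-1 * (l%:R * eta) = eta * (l%:R * (1 + e2^-1)) by ring.
  by rewrite /eta divfK// gt_eqF.
have [J hJ] := hQt eta0.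
pose C := 1 + 16 * (10 * D) * l%:R.
have e14 : 0 < e1 / 4 by rewrite divr_gt0.
have [K1 hK1] := expr_eventually_lt (e2^-1 * C) hr e14.
have eps20 : 0 < eps / 2 by rewrite divr_gt0.
have [K2 hK2] := expr_eventually_lt 2 (powR_lt1 hr eps20) (@ltr01 R).
pose L := maxn (maxn K1 K2) (maxn J 1).
have LK1 : (K1 <= L)%N by rewrite !leq_max leqnn ?orbT.
have LK2 : (K2 <= L)%N by rewrite !leq_max leqnn ?orbT.
have LJ : (J <= L)%N by rewrite !leq_max leqnn ?orbT.
have L0 : (0 < L)%N by rewrite !leq_max leqnn ?orbT.
pose N := (l * L)%N; have N0 : (0 < N)%N by rewrite muln_gt0 l0.
(* One L more than the projection estimate loses, so that dividing by rho leaves r^L, small for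
   large L; the total loss 2L is at most N eps / 4 since 1/l <= eps/8. *)
pose rho := r `^ (N%:R * t - 2 * L%:R).
have rho0 : 0 < rho by rewrite powR_gt0.
have rhoE : rho^-1 * (C * r `^ (N%:R * t - L%:R)) = C * r ^+ L.
  rewrite mulrCA /rho -powRN -powRD; last by rewrite (gt_eqF r0) implybT.
  rewrite -(powR_mulrn L); last exact: ltW.
  by congr (_ * powR _ _); ring.
have hJL j : (L <= j)%N -> fine (Q (heavy_event t eta j)) <= eta.
  by move=> Lj; apply: hJ; exact: leq_trans Lj.
have [c hc] := sum_bad_event_le l0 L0 e20 rho0 eta0 hJL.
pose phi := N%:R * theta.
(* The net of angles i r^N is countable, and every b >= 0 lies within r^N of a member. *)
pose B i k := bad_event (10 * D) rho (i%:R * r ^+ N - k%:R * phi) N e2.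
pose m0 := (Num.truncn (c / (e1 / 2))).+1.
have hBs (i : nat) m : (m0 <= m)%N ->
    \sum_(0 <= k < m) fine (Q (B i k)) <= m%:R * expR (- (2 * M'%:R)).
  move=> m0m; apply: le_trans (hc _ m) _.
  rewrite -/N -/C rhoE (mulrDr e2^-1) addrA etaE mulrA -/e1.
  have h1 : e2^-1 * C * r ^+ L < e1 / 4 by exact: hK1.
  have h2 : c <= m%:R * (e1 / 2).
    rewrite -ler_pdivrMr ?divr_gt0//; apply/ltW; apply: lt_le_trans (truncnS_gt _) _.
    by rewrite ler_nat.
  have h3 : m%:R * (e1 / 4 + e2^-1 * C * r ^+ L) <= m%:R * (e1 / 2).
    by rewrite ler_wpM2l//; lra.
  by lra.
have hae (i : nat) : {ae Q, forall om : OmegaN Omega,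
    exists m1, forall m, (m1 <= m)%N -> (M' * hits N (B i) m om < m)%N}.
  apply: (ae_few_hits hQ _ _ M'0 (hBs i)) => k.
  - exact: measurable_bad_event.
  - exact: determined_bad_event.
have /ae_foralln : forall i : nat, {ae Q, forall om : OmegaN Omega,
    exists m1, forall m, (m1 <= m)%N -> (M' * hits N (B i) m om < m)%N} by exact: hae.
apply: filterS => om hom b /andP[b0 bpi].
have rN : 0 < r ^+ N by rewrite exprn_gt0.
pose i := Num.truncn (b / r ^+ N).
have /andP[i1 i2] := truncn_itv (divr_ge0 b0 (ltW rN)).
rewrite -/i ler_pdivlMr// in i1; rewrite -/i ltr_pdivrMr// -natr1 in i2.
have bi : `|b - i%:R * r ^+ N| <= r ^+ N by rewrite ler_norml; apply/andP; split; lra.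
have [m1 hm1] := hom i.
have s0 : 0 < t - eps by rewrite subr_gt0.
pose PP m w := (M * bad_count r theta a N rho m b (pom X om) w < m)%N.
apply: (@proj_dim_ge _ _ r theta a hr (nu om) (pom X om) (nu_cyl om) (pvec_pom om)
  b (t - eps) N PP m1 N0 s0) => [m mm1|m x mm1].
  have -> : (fun w => (~~ PP m w)%:R) =
      (fun w => (m <= M * bad_count r theta a N rho m b (pom X om) w)%N%:R) :> (_ -> R).
    by apply/funext => w; rewrite /PP -leqNgt.
  apply: Ex_many_bad; first exact: pvec_pom.
  rewrite -/e0.
  pose hit j : R := `[< B i j (seq_shift (j * N)%N om) >]%:R.
  (* A block has bad mass at most [e2] unless its environment is a hit, in which case 1 is a
     bound. *)
  apply: (@le_trans _ _ (\sum_(0 <= j < m) (e2 + hit j))).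
    apply: ler_sum => j _.
    apply: (@le_trans _ _ (bad_word_mass r theta a (10 * D) rho (i%:R * r ^+ N - j%:R * phi) N
        (pom X (seq_shift (j * N)%N om)))).
      apply: bad_mass_angle => //; first exact: pvec_pom.
      by rewrite opprB addrA subrK.
    rewrite /hit; case: asboolP => h.
      apply: (@le_trans _ _ 1); last by rewrite lerDr ltW.
      by apply: Ex_le_cst; [exact: pvec_pom|move=> w _; rewrite lern1 leq_b1].
    by rewrite addr0 leNgt; apply/negP.
  rewrite big_split /= sumr_const_nat subn0 -natr_sum -[e2 *+ m]mulr_natl.
  have h1 : (M' * hits N (B i) m om <= m)%N by apply/ltnW/hm1.
  have M'R : 0 < M'%:R :> R by rewrite ltr0n.
  have h2 : M'%:R * (hits N (B i) m om)%:R <= m%:R :> R by rewrite -natrM ler_nat.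
  have h3 : (hits N (B i) m om)%:R <= m%:R * M'%:R^-1 :> R by rewrite ler_pdivlMr// mulrC.
  have h4 : m%:R * M'%:R^-1 <= m%:R * (e0 / 2) :> R by rewrite ler_wpM2l.
  by move: h3; rewrite /hits /e2; lra.
have lL : N%:R = l%:R * L%:R :> R by rewrite /N natrM.
have LR : 0 <= L%:R :> R by [].
have lt2 : 2 <= l%:R * t by apply: le_trans l2 _; rewrite ler_pM2l//; lra.
have expo0 : 0 <= N%:R * t - 2 * L%:R.
  have -> : N%:R * t - 2 * L%:R = (l%:R * t - 2) * L%:R by rewrite lL; ring.
  by rewrite mulr_ge0// subr_ge0.
have rho1 : rho <= 1 by rewrite -(powRr0 r); apply: powr_le.
apply: le_trans (ball_few_bad_le theta a hr N rho0 m b x (pvec_pom om) M0 rho1) _.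
have pos : 0 <= 2 * rho `^ (1 - M%:R^-1) by rewrite mulr_ge0// powR_ge0.
apply: lerXn2r; rewrite ?nnegrE ?powR_ge0//.
have LN : L%:R <= N%:R :> R by rewrite ler_nat leq_pmull.
have MR : 0 <= M%:R^-1 :> R by rewrite invr_ge0.
rewrite -(powR_mulrn N (ltW r0)) -powRrM /rho -powRrM.
(* The 2L and the factor 1 - 1/M each cost N eps / 4; the remaining N eps / 2 absorbs the factor 2
   through [K2]. *)
apply: (@le_trans _ _ (2 * r `^ (N%:R * (eps / 2) + N%:R * (t - eps)))).
  rewrite ler_pM2l//; apply: powr_le => //.
  have h1 : 2 * L%:R <= N%:R * (eps / 4).
    by rewrite lL -mulrA (mulrC L%:R) mulrA ler_wpM2r.
  have h2 : (N%:R * t - 2 * L%:R) * M%:R^-1 <= N%:R * (eps / 4).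
    apply: ler_pM => //; have : N%:R * t <= N%:R by rewrite ler_piMr// ltW.
    by lra.
  have -> : (N%:R * t - 2 * L%:R) * (1 - M%:R^-1) =
    (N%:R * t - 2 * L%:R) - (N%:R * t - 2 * L%:R) * M%:R^-1 by ring.
  by lra.
rewrite powRD; last by rewrite (gt_eqF r0) implybT.
rewrite mulrA ler_piMl ?powR_ge0//.
rewrite mulrC -[X in X * _](_ : (r `^ (eps / 2)) ^+ N = _); last first.
  by rewrite -powR_mulrn ?powR_ge0// -powRrM mulrC.
rewrite mulrC; apply/ltW/hK2; rewrite (leq_trans LK2)// leq_pmull//.
Qed.

End LightCase.

Lemma ae_dichotomy (t eps : R) : 0 < t < 1 -> 0 < eps < t ->
  {ae Q, forall om : OmegaN Omega, (image_dim om <= (t + eps + eps)%:E)%E \/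
    forall b : R, 0 <= b < pi -> ((t - eps)%:E <= proj_dim om b)%E}.
Proof.
move=> t01 heps; have /andP[t0 t1] := t01; have /andP[eps0 _] := heps.
have [hQt|] := pselect (forall eta : R, 0 < eta ->
    exists J : nat, forall j, (J <= j)%N -> fine (Q (heavy_event t eta j)) <= eta).
  by apply: filterS (ae_proj_dim_ge t01 hQt heps) => om h; right.
move=> /existsNP[eta /not_implyP[eta0 hJ]].
(* The same number bounds the heavy mass and the probability from below; it is kept below 1 for the
   Borel-Cantelli argument, and lowering it enlarges the event. *)
pose eta' := Num.min eta 2^-1.
have eta'01 : 0 < eta' < 1.
  by rewrite lt_min eta0 invr_gt0 ltr0n/= gt_min invf_lt1// ltr1n orbT.
have h : {ae Q, forall om : OmegaN Omega, (image_dim om <= (t + eps + eps)%:E)%E}.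
  apply: (@ae_image_dim_le t eps eta') => //; first exact: ltW.
  move=> J; apply: contrapT => hn; apply: hJ; exists J => j Jj.
  rewrite leNgt; apply/negP => h; apply: hn; exists j; split => //.
  have e1 : eta' <= eta by rewrite ge_min lexx.
  apply: (le_trans e1 (le_trans (ltW h) _)).
  apply: fineQ_le; [exact: measurable_heavy_event|exact: measurable_heavy_event|].
  by move=> om; exact: (le_lt_trans e1).
by apply: filterS h => om h; left.
Qed.

Lemma ae_proj_dim_eq :
  {ae Q, forall om : OmegaN Omega, forall b : R, 0 <= b < pi ->
     proj_dim om b = Order.min 1%E (image_dim om)}.
Proof.
(* Rational pairs make the exceptional set a countable union; the default pair gives t = 0, for
   which [S] is vacuous. *)
pose te (k : nat) : rat * rat := odflt (0, 0) (unpickle k).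
pose tt k : R := ratr (te k).1; pose ee k : R := ratr (te k).2.
pose S k (om : OmegaN Omega) := 0 < tt k < 1 -> 0 < ee k < tt k ->
  (image_dim om <= (tt k + ee k + ee k)%:E)%E \/
  forall b : R, 0 <= b < pi -> ((tt k - ee k)%:E <= proj_dim om b)%E.
have /ae_foralln : forall k, {ae Q, forall om, S k om}.
  move=> k; have [ht|ht] := pselect (0 < tt k < 1); last first.
    by apply: aeW => om h; case: (ht h).
  have [he|he] := pselect (0 < ee k < tt k); last first.
    by apply: aeW => om _ h; case: (he h).
  by apply: filterS (ae_dichotomy ht he) => om h _ _.
apply: filterS => om hom b hb.
apply/eqP; rewrite eq_le; apply/andP; split.
  rewrite le_min; apply/andP; split.
    exact: (@proj_dim_le1 _ _ r theta a hr (nu om) (pom X om) (nu_cyl om) b).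
  exact: (proj_dim_le_image_dim theta a hr (nu om) b).
rewrite leNgt; apply/negP; rewrite lt_min => /andP[h1 h2].
have p0 := dimH_meas_ge0 (fun A => nu om (coding @^-1` (proj_line b @^-1` A))).
have pf : proj_dim om b \is a fin_num.
  by rewrite fin_numElt (lt_le_trans _ p0)//= (lt_trans h1)// ltry.
pose x := fine (proj_dim om b).
have xE : proj_dim om b = x%:E by rewrite fineK.
rewrite xE lee_fin in p0; rewrite xE lte_fin in h1; rewrite xE in h2.
have [y [xy y1 hy]] : exists y : R, [/\ x < y, y <= 1 & (y%:E <= image_dim om)%E].
  have [hd|hd] := leP 1%E (image_dim om); first by exists 1.
  have df : image_dim om \is a fin_num.
    by rewrite fin_numElt (lt_le_trans _ (dimH_meas_ge0 _))//= (lt_trans hd)// ltry.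
  exists (fine (image_dim om)); split.
  - by rewrite -lte_fin (fineK df).
  - by rewrite -lee_fin (fineK df) ltW.
  - by rewrite (fineK df).
(* With e < (y - x)/4 there is room for t between x + e and y - 2e, and then both alternatives of
   the dichotomy fail. *)
have yx4 : 0 < (y - x) / 4 by lra.
have [e] := rat_in_itvoo yx4; rewrite in_itv/= => /andP[e0 e1].
have xy2 : x + ratr e < y - ratr e - ratr e by lra.
have [t] := rat_in_itvoo xy2; rewrite in_itv/= => /andP[t0 t1].
have := hom (pickle (t, e)); rewrite /S /tt /ee /te pickleK /= => /(_ _ _)[||h|h].
- by apply/andP; split; lra.
- by apply/andP; split; lra.
- have := le_trans hy h; rewrite lee_fin; lra.
- have := h b hb; rewrite xE lee_fin; lra.
Qed.

End RandomMeasure.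

Unset Implicit Arguments.
Set Strict Implicit.
Set Printing Implicit Defensive.

(* The IFS has m = n.+1 maps, indexed by Lam n = 'I_n.+1. *)
Theorem theorem4p3 (R : realType) (n : nat) (r theta : R) (a : Lam n -> R * R)
  (d : measure_display) (Omega : measurableType d) (P : probability Omega R)
  (X : Omega -> Lam n -> R)
  (Q : probability (OmegaN Omega) R)
  (nu : (nat -> Omega) -> {measure set (Sigma n) -> \bar R}) :
  0 < r < 1 ->
  0 <= theta < 2 * pi ->
  ~ (exists q : rat, theta / pi = ratr q) ->
  (* X is a random probability vector *)
  (forall i, measurable_fun setT (fun w => X w i)) ->
  (forall w, (forall i, 0 <= X w i <= 1) /\ \sum_i X w i = 1) ->
  (* Omega^N carries the product probability P^{(x)N}; X^(k)(om) = X (om k) *)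
  is_product_measure P Q ->
  (* nu_om([w_0...w_{k-1}]) = X^(1)_{w_0} ... X^(k)_{w_{k-1}} *)
  (forall (om : nat -> Omega) (w : nat -> Lam n) (k : nat),
      nu om (cyl w k) = (\prod_(j < k) X (om j) (w j))%:E) ->
  {ae Q, forall om : OmegaN Omega,
     forall beta : R, 0 <= beta < pi ->
       dimH_meas (fun A => nu om (coding r theta a @^-1` (proj_line beta @^-1` A)))
       = Order.min 1%E (dimH_meas (fun A => nu om (coding r theta a @^-1` A)))}.
Proof.
move=> hr _ theta_irr mX hX hQ nu_cyl.
exact: (ae_proj_dim_eq a hr theta_irr mX hX hQ nu_cyl).
Qed.
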